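(* Let $d \in \mathbb{N}$ and let $K$ be a normed field. Then the singular homology functor $H_d(\,\cdot\,;K)$, regarded as a functor to $\mathsf{Vect}_K$ on the category of all topological spaces that are homotopy equivalent to finite CW-complexes (with all continuous maps as morphisms), admits a universal finite functorial semi-norm.
   Context: Here $\mathbb{N}$ includes $0$. A normed field is a field $K$ with a multiplicative norm (absolute value) $|\cdot| \colon K \to \mathbb{R}_{\ge 0}$, e.g. $\mathbb{Q}$ or $\mathbb{R}$ with the standard norm. $\mathsf{Vect}_K$ is the category of $K$-vector spaces and $K$-linear maps. A semi-norm on a $K$-vector space $V$ is a function $|\cdot| \colon V \to \mathbb{R}_{\geq 0}\cup\{\infty\}$ with $|0| = 0$, $|x+y| \le |x|+|y|$ for all $x,y\in V$, and $|a\cdot x| = |a|\cdot|x|$ for all $a \in K\setminus\{0\}$, $x \in V$ (with the usual conventions regarding $\infty$). It is finite if it does not attain $\infty$. Let $F \colon C \to \mathsf{Vect}_K$ be a functor. A functorial semi-norm $\sigma$ on $F$ consists of a semi-norm $|\cdot|_\sigma$ on $F(X)$ for every object $X$ of $C$ such that for all morphisms $f\colon X \to Y$ of $C$ and all $\alpha \in F(X)$ we have $|F(f)(\alpha)|_\sigma \le |\alpha|_\sigma$. It is finite if $|\cdot|_\sigma$ is finite on $F(X)$ for all $X$. For functorial semi-norms $\sigma,\tau$ on $F$, $\sigma$ carries $\tau$ if for all objects $X$ of $C$ and all $\alpha \in F(X)$: $|\alpha|_\sigma = 0$ implies $|\alpha|_\tau = 0$. A universal finite functorial semi-norm on $F$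 is a finite functorial semi-norm on $F$ that carries all finite functorial semi-norms on $F$. *)

(* Defs.v *)
From HB Require Import structures.
From mathcomp Require Import all_boot all_order all_algebra.
From mathcomp Require Import all_classical all_reals ereal topology normedtype.
From mathcomp.multinomials Require Import freeg.
From mathcomp Require Import zify.

Set Implicit Arguments.
Unset Strict Implicit.
Unset Printing Implicit Defensive.

Import Order.TTheory GRing.Theory Num.Theory.
Import numFieldNormedType.Exports.

Local Open Scope classical_set_scope.
Local Open Scope ring_scope.

Record field_norm (R : realType) (K : fieldType) := FieldNorm {
  fnorm :> K -> R;
  fnorm_ge0 : forall x, 0 <= fnorm x;
  fnorm_eq0 : forall x, fnorm x = 0 <-> x = 0;
  fnormM : forall x y, fnorm (x * y) = fnorm x * fnorm y;
  fnormD : forall x y, fnorm (x + y) <= fnorm x + fnorm y }.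

Record category := Category {
  obj :> Type;
  hom : obj -> obj -> Type;
  idm : forall X, hom X X;
  compm : forall X Y Z, hom Y Z -> hom X Y -> hom X Z;
  comp1m : forall X Y (f : hom X Y), compm (idm Y) f = f;
  compm1 : forall X Y (f : hom X Y), compm f (idm X) = f;
  compmA : forall W X Y Z (h : hom Y Z) (g : hom X Y) (f : hom W X),
    compm h (compm g f) = compm (compm h g) f }.

Arguments hom {c}.
Arguments idm {c}.
Arguments compm {c X Y Z}.

Record vect_functor (K : fieldType) (C : category) := VectFunctor {
  fobj :> C -> lmodType K;
  fmap : forall X Y : C, hom X Y -> {linear fobj X -> fobj Y};
  fmap_id : forall (X : C) (a : fobj X), fmap (idm X) a = a;
  fmap_comp : forall (X Y Z : C) (g : hom Y Z) (f : hom X Y) (a : fobj X),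
    fmap (compm g f) a = fmap g (fmap f a) }.

Arguments fmap {K C} v {X Y}.

Section FullSubcategory.
Variables (C : category) (P : C -> Prop).

Definition full_subcategory : category := {|
  obj := {X : C | P X};
  hom := fun X Y => hom (sval X) (sval Y);
  idm := fun X => idm (sval X);
  compm := fun X Y Z g f => compm g f;
  comp1m := fun X Y f => comp1m f;
  compm1 := fun X Y f => compm1 f;
  compmA := fun W X Y Z h g f => compmA h g f |}.

Definition restrict_functor (K : fieldType) (F : vect_functor K C) :
    vect_functor K full_subcategory := {|
  fobj := fun X : full_subcategory => F (sval X);
  fmap := fun (X Y : full_subcategory) f => @fmap _ _ F (sval X) (sval Y) f;
  fmap_id := fun X => @fmap_id _ _ F (sval X);
  fmap_comp := fun X Y Z g f => @fmap_comp _ _ F _ _ _ g f |}.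

End FullSubcategory.

Record seminorm (R : realType) (K : fieldType) (nrm : field_norm R K)
    (V : lmodType K) := Seminorm {
  sn :> V -> \bar R;
  sn_ge0 : forall x, (0 <= sn x)%E;
  sn0 : sn 0 = 0%E;
  snD : forall x y, (sn (x + y) <= sn x + sn y)%E;
  snZ : forall a x, a != 0 -> sn (a *: x) = ((nrm a)%:E * sn x)%E }.

Section FunctorialSeminorms.
Variables (R : realType) (K : fieldType) (nrm : field_norm R K).
Variables (C : category) (F : vect_functor K C).

Record functorial_seminorm := FunctorialSeminorm {
  fsn :> forall X : C, seminorm nrm (F X);
  fsn_le : forall (X Y : C) (f : hom X Y) (a : F X),
    (fsn Y (fmap F f a) <= fsn X a)%E }.

Definition finite_fsn (s : functorial_seminorm) :=
  forall (X : C) (a : F X), s X a <> +oo%E.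

Definition carries (s t : functorial_seminorm) :=
  forall (X : C) (a : F X), s X a = 0%E -> t X a = 0%E.

Definition universal_finite_fsn (s : functorial_seminorm) :=
  finite_fsn s /\ forall t, finite_fsn t -> carries s t.

End FunctorialSeminorms.

Lemma cts_compA (W X Y Z : topologicalType) (h : continuousType Y Z)
    (g : continuousType X Y) (f : continuousType W X) :
  (h \o (g \o f) : continuousType W Z) = ((h \o g) \o f : continuousType W Z).
Proof. exact/continuousEP. Qed.

Lemma cts_comp1 (X Y : topologicalType) (f : continuousType X Y) :
  (idfun \o f : continuousType X Y) = f.
Proof. exact/continuousEP. Qed.

Lemma cts_compm1 (X Y : topologicalType) (f : continuousType X Y) :
  (f \o idfun : continuousType X Y) = f.
Proof. exact/continuousEP. Qed.

Definition Top : category := {|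
  obj := topologicalType;
  hom := fun X Y => continuousType X Y;
  idm := fun X => (idfun : continuousType X X);
  compm := fun X Y Z g f => (g \o f : continuousType X Z);
  comp1m := cts_comp1;
  compm1 := cts_compm1;
  compmA := cts_compA |}.

Definition homotopic (R : realType) (X Y : topologicalType)
    (f g : continuousType X Y) :=
  exists H : X * R -> Y,
    [/\ {within [set: X] `*` `[0, 1], continuous H},
        forall x, H (x, 0) = f x
      & forall x, H (x, 1) = g x].

Definition homotopy_equivalent (R : realType) (X Y : topologicalType) :=
  exists (f : continuousType X Y) (g : continuousType Y X),
    homotopic R (g \o f : continuousType X X) (idfun : continuousType X X) /\
    homotopic R (f \o g : continuousType Y Y) (idfun : continuousType Y Y).

(* The Euclidean norm, squared: `|t| is the supremum norm on 'rV[R]_n. *)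
Definition sqnorm (R : realType) n (t : 'rV[R]_n) : R := \sum_i t ord0 i ^+ 2.

Definition disk (R : realType) n : set 'rV[R]_n := [set t | sqnorm t <= 1].
Arguments disk : clear implicits.

Definition open_disk (R : realType) n : set (disk R n) :=
  [set t | sqnorm (val t) < 1].
Arguments open_disk : clear implicits.

Definition sphere (R : realType) n : set (disk R n) :=
  [set t | sqnorm (val t) = 1].
Arguments sphere : clear implicits.

Record finite_CW_structure (R : realType) (X : topologicalType) :=
  FiniteCWStructure {
    cw_cell : finType;
    cw_dim : cw_cell -> nat;
    cw_char : forall e, continuousType (disk R (cw_dim e)) X;
    cw_open_cell := fun e => cw_char e @` open_disk R (cw_dim e);
    cw_hausdorff : hausdorff_space X;
    (* cw_char e restricts to a homeomorphism from the open disk to the cell *)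
    cw_homeo : forall e, exists g : X -> disk R (cw_dim e),
      {within cw_open_cell e, continuous g} /\
      {in open_disk R (cw_dim e), cancel (cw_char e) g};
    cw_partition : forall x, exists! e, cw_open_cell e x;
    cw_attach : forall e x, (cw_char e @` sphere R (cw_dim e)) x ->
      exists2 e', (cw_dim e' < cw_dim e)%N & cw_open_cell e' x;
    cw_weak : forall A : set X,
      (forall e, closed (cw_char e @^-1` A)) -> closed A }.

Definition finite_CW_type (R : realType) (X : topologicalType) :=
  exists2 Y : topologicalType, inhabited (finite_CW_structure R Y) &
    homotopy_equivalent R X Y.

Section FgliftTheory.
Variables (K : fieldType) (T : choiceType) (V : lmodType K) (f : T -> V).

Lemma fglift_is_linear : linear (fglift f).
Proof.
have fB : {morph fglift f : x y / x - y} by exact: lift_is_additive.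
have f0 : fglift f 0 = 0 by rewrite -(subrr 0) fB subrr.
have fN : {morph fglift f : x / - x} by move=> x; rewrite -sub0r fB f0 sub0r.
have fD : {morph fglift f : x y / x + y}.
  by move=> x y; rewrite -{1}[y]opprK fB fN opprK.
move=> c x y; rewrite fD; congr (_ + _).
have fS (s : seq T) (F : T -> {freeg T / K}) :
    fglift f (\sum_(i <- s) F i) = \sum_(i <- s) fglift f (F i).
  elim: s => [|i s IHs]; first by rewrite !big_nil.
  by rewrite !big_cons fD IHs.
rewrite -{2}[x]freeg_sumE {1}/GRing.scale/= /fgscale !fS scaler_sumr.
by apply: eq_bigr => i _; rewrite !liftU scalerA.
Qed.

HB.instance Definition _ := GRing.isLinear.Build K {freeg T / K} V _
  (fglift f) fglift_is_linear.

End FgliftTheory.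

Lemma freeg_ext (K : fieldType) (T : choiceType) (V : lmodType K)
    (f g : {linear {freeg T / K} -> V}) :
  (forall x, f (Freeg [:: (1, x)]) = g (Freeg [:: (1, x)])) -> f =1 g.
Proof.
move=> fg D; rewrite -[D]freeg_sumE !linear_sum; apply: eq_bigr => x _.
suff -> : Freeg [:: (coeff x D, x)] = coeff x D *: Freeg [:: (1, x)].
  by rewrite !linearZ /= fg.
by apply/eqP/freeg_eqP => y; rewrite coeffZ !coeffU mul1r.
Qed.

Section QuotientModule.
Variables (K : fieldType) (V : lmodType K) (I : submodClosed V).

Definition quot_mem : {pred V} := fun v => v \in I.

HB.instance Definition _ := GRing.isZmodClosed.Build V quot_mem
  (GRing.submod_closedB (submodClosedP I)).

Definition quotmod := Quotient.quot quot_mem.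

HB.instance Definition _ := GRing.Zmodule.on quotmod.

Definition quot_pr (v : V) : quotmod := (\pi_(Quotient.quot quot_mem) v)%qT.

Lemma quot_prP u v : quot_pr u = quot_pr v <-> u - v \in I.
Proof.
rewrite -[_ \in I]/(u - v \in quot_mem) Quotient.idealrBE.
by split => [uv|/eqP//]; exact/eqP.
Qed.

Lemma quot_pr_surj a : exists v, quot_pr v = a.
Proof. by exists (repr a); exact: reprK. Qed.

Definition quotmod_scale (c : K) (a : quotmod) : quotmod :=
  quot_pr (c *: repr a).

Lemma quot_pr_scale c v : quotmod_scale c (quot_pr v) = quot_pr (c *: v).
Proof.
apply/quot_prP; rewrite -scalerBr; apply: rpredZ; apply/quot_prP; exact: reprK.
Qed.

Lemma quot_prD u v : quot_pr (u + v) = quot_pr u + quot_pr v.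
Proof. exact: raddfD. Qed.

Fact quotmod_scaleA a b v :
  quotmod_scale a (quotmod_scale b v) = quotmod_scale (a * b) v.
Proof.
by have [u <-] := quot_pr_surj v; rewrite !quot_pr_scale scalerA.
Qed.

Fact quotmod_scale1 : left_id 1 quotmod_scale.
Proof.
by move=> v; have [u <-] := quot_pr_surj v; rewrite quot_pr_scale scale1r.
Qed.

Fact quotmod_scaleDr : right_distributive quotmod_scale +%R.
Proof.
move=> a v v'; have [u <-] := quot_pr_surj v; have [u' <-] := quot_pr_surj v'.
by rewrite -quot_prD !quot_pr_scale -quot_prD scalerDr.
Qed.

Fact quotmod_scaleDl v :
  {morph quotmod_scale^~ v : a b / a + b >-> a + b}.
Proof.
move=> a b; have [u <-] := quot_pr_surj v.
by rewrite !quot_pr_scale -quot_prD scalerDl.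
Qed.

HB.instance Definition _ := GRing.Zmodule_isLmodule.Build K quotmod
  quotmod_scaleA quotmod_scale1 quotmod_scaleDr quotmod_scaleDl.

Fact quot_pr_is_linear : linear quot_pr.
Proof. by move=> c u v; rewrite quot_prD -quot_pr_scale. Qed.

HB.instance Definition _ := GRing.isLinear.Build K V quotmod _
  quot_pr quot_pr_is_linear.

End QuotientModule.

Section QuotientMap.
Variables (K : fieldType) (V W : lmodType K).
Variables (I : submodClosed V) (J : submodClosed W) (f : {linear V -> W}).

Definition quotmod_map (_ : forall v, v \in I -> f v \in J)
  (a : quotmod I) : quotmod J := quot_pr J (f (repr a)).

Hypothesis fIJ : forall v, v \in I -> f v \in J.

Lemma quotmod_mapE v : quotmod_map fIJ (quot_pr I v) = quot_pr J (f v).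
Proof.
apply/quot_prP; rewrite -linearB; apply: fIJ; apply/quot_prP; exact: reprK.
Qed.

Fact quotmod_map_is_linear : linear (quotmod_map fIJ).
Proof.
move=> c a b; have [u <-] := quot_pr_surj a; have [v <-] := quot_pr_surj b.
by rewrite -linearP !quotmod_mapE linearP linearP.
Qed.

HB.instance Definition _ := GRing.isLinear.Build K (quotmod I) (quotmod J) _
  (quotmod_map fIJ) quotmod_map_is_linear.

End QuotientMap.

Definition simplex (R : realType) n : set 'rV[R]_n.+1 :=
  [set t | (forall i, 0 <= t ord0 i) /\ \sum_i t ord0 i = 1].
Arguments simplex : clear implicits.

Section Faces.
Variable R : realType.

Definition face_row n (i : 'I_n.+2) (t : 'rV[R]_n.+1) : 'rV[R]_n.+2 :=
  \row_j oapp (t ord0) 0 (unlift i j).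

Lemma face_rowE n (i : 'I_n.+2) (t : 'rV[R]_n.+1) k :
  face_row i t ord0 (fintype.lift i k) = t ord0 k.
Proof. by rewrite mxE liftK. Qed.

Lemma face_row0 n (i : 'I_n.+2) (t : 'rV[R]_n.+1) : face_row i t ord0 i = 0.
Proof. by rewrite mxE unlift_none. Qed.

Definition swap_faces n (p : 'I_n.+3 * 'I_n.+2) : 'I_n.+3 * 'I_n.+2 :=
  (fintype.lift ord0 p.2, inord p.1).

Lemma face_row_swap n (p : 'I_n.+3 * 'I_n.+2) (t : 'rV[R]_n.+1) :
  (p.1 <= p.2)%N -> face_row p.1 (face_row p.2 t) =
  face_row (swap_faces p).1 (face_row (swap_faces p).2 t).
Proof.
case: p => i j /= ij.
have vi : (inord i : 'I_n.+2) = i :> nat.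
  by rewrite inordK // (leq_ltn_trans ij).
have lij l : fintype.lift i (fintype.lift j l) =
    fintype.lift (fintype.lift ord0 j) (fintype.lift (inord i : 'I_n.+2) l).
  by apply: val_inj; rewrite /= vi /bump; lia.
apply/rowP => k.
case: (unliftP i k) => [k' ->|->].
  rewrite face_rowE; case: (unliftP j k') => [l ->|->].
    by rewrite lij !face_rowE.
  rewrite face_row0 (_ : fintype.lift i j = fintype.lift ord0 j) ?face_row0 //.
  by apply: val_inj; rewrite /= /bump; lia.
rewrite face_row0 [X in face_row _ _ ord0 X](_ : i =
  fintype.lift (fintype.lift ord0 j) (inord i : 'I_n.+2)) ?face_rowE ?face_row0 //.
by apply: val_inj; rewrite /= vi /bump; lia.
Qed.

Lemma face_row_simplex n i (t : simplex R n) :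
  face_row i (val t) \in simplex R n.+1.
Proof.
case: t => t /= /[!inE] -[t0 t1]; split=> [j|].
  by rewrite mxE; case: unlift => /=.
rewrite (bigD1_ord i) //= mxE unlift_none add0r -t1.
by apply: eq_bigr => j _; rewrite mxE liftK.
Qed.

Definition face_fun n (i : 'I_n.+2) (t : simplex R n) : simplex R n.+1 :=
  exist _ (face_row i (val t)) (face_row_simplex i t).

Lemma face_continuous n (i : 'I_n.+2) : continuous (@face_fun n i).
Proof.
apply: continuous_comp_initial => t A [P nP sPA].
have cval : continuous (val : simplex R n -> 'rV[R]_n.+1).
  exact: initial_continuous.
have cj j : continuous (fun t : simplex R n => face_row i (val t) ord0 j).
  rewrite [X in continuous X](_ : _ =
    fun t : simplex R n => oapp (val t ord0) 0 (unlift i j)); last first.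
    by apply/funext => u; rewrite mxE.
  case: unlift => [k|] /=; last exact: cst_continuous.
  move=> u.
  exact: (continuous_comp (cval u) (@coord_continuous R 1 n.+1 ord0 k _)).
have : \forall u \near t, forall j, P ord0 j (face_row i (val u) ord0 j).
  apply: (@filter_forall _ _ _ (nbhs t)) => j; exact: (cj j t _ (nP ord0 j)).
apply: filterS => u uP; apply: sPA => a j; rewrite (ord1 a); exact: uP.
Qed.

HB.instance Definition _ n (i : 'I_n.+2) :=
  isContinuous.Build (simplex R n) (simplex R n.+1) (face_fun i)
    (@face_continuous n i).

Definition face n (i : 'I_n.+2) :
    continuousType (simplex R n) (simplex R n.+1) :=
  face_fun i.

End Faces.

Section SingularHomology.
Variables (R : realType) (K : fieldType).

Definition singular_simplex n (X : topologicalType) :=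
  continuousType (simplex R n) X.

HB.instance Definition _ n X := Choice.on (singular_simplex n X).

Definition chains n (X : topologicalType) := {freeg (singular_simplex n X) / K}.

HB.instance Definition _ n X := GRing.Lmodule.on (chains n X).

Definition chain1 n X (s : singular_simplex n X) : chains n X :=
  Freeg [:: (1, s)].

Definition boundary n X : chains n.+1 X -> chains n X :=
  fglift (fun s : singular_simplex n.+1 X =>
    \sum_(i < n.+2) (-1) ^+ i *:
      chain1 (s \o face R i : singular_simplex n X)).

HB.instance Definition _ n X := GRing.Linear.on (@boundary n X).

Lemma boundary1 n X (s : singular_simplex n.+1 X) :
  boundary (chain1 s) = \sum_(i < n.+2) (-1) ^+ i *:
      chain1 (s \o face R i : singular_simplex n X).
Proof. by rewrite /boundary liftU scale1r. Qed.

Lemma boundary_boundary n X (c : chains n.+2 X) :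
  boundary (boundary c) = 0.
Proof.
apply: (@freeg_ext _ _ _ (@boundary n X \o @boundary n.+1 X) \0) => s /=.
rewrite -/(chain1 s) boundary1 linear_sum /=.
under eq_bigr => i _ do rewrite linearZ /= boundary1 scaler_sumr.
rewrite pair_big /= (bigID (fun p : 'I_n.+3 * 'I_n.+2 => p.1 <= p.2)%N) /=.
rewrite [X in _ + X](reindex_onto (@swap_faces n)
  (fun q : 'I_n.+3 * 'I_n.+2 => (inord q.2 : 'I_n.+3, inord q.1.-1 : 'I_n.+2)));
  last first.
  case=> i j /=; rewrite -ltnNge => ji; congr pair; apply: val_inj.
    by rewrite /= /bump inordK; move: (ltn_ord i); lia.
  rewrite /= inordK; rewrite inordK //; move: (ltn_ord j); lia.
rewrite [X in _ + X](eq_bigl (fun p : 'I_n.+3 * 'I_n.+2 => p.1 <= p.2)%N);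
  last first.
  case=> i j /=; rewrite /bump /=; apply/idP/idP; last first.
    move=> ij.
    have vi : (inord i : 'I_n.+2) = i :> nat.
      by rewrite inordK // (leq_ltn_trans ij).
    apply/andP; split; first by rewrite vi; lia.
    apply/eqP; congr pair; apply: val_inj => /=.
      by rewrite vi inordK //; move: (ltn_ord i); lia.
    by rewrite inordK; move: (ltn_ord j); lia.
  move=> /andP[+ /eqP[ei ej]].
  rewrite -ltnNge /= => h; rewrite -ei inordK;
    last by move: (ltn_ord (inord i : 'I_n.+2)); lia.
  lia.
rewrite -big_split /= big1 // => -[i j] /= ij.
have vi : (inord i : 'I_n.+2) = i :> nat.
  by rewrite inordK // (leq_ltn_trans ij).
rewrite !scalerA -!exprD /= vi /bump leq0n add1n addSn exprS mulN1r scaleNr addnC.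
apply/eqP; rewrite subr_eq0; apply/eqP; congr (_ *: chain1 _).
apply/continuousEP => t /=; congr (s _); apply: val_inj => /=.
exact: (@face_row_swap R n (i, j)).
Qed.
Definition is_cycle n X : {pred chains n X} :=
  match n with
  | 0 => fun=> true
  | m.+1 => fun c : chains m.+1 X => boundary c == 0
  end.

Fact is_cycle_submod n X : submod_closed (@is_cycle n X).
Proof.
case: n => [|n]; first by [].
split=> [|c u v]; rewrite !unfold_in /=; first by rewrite linear0.
by move=> /eqP u0 /eqP v0; rewrite linearP /= u0 v0 scaler0 addr0.
Qed.

HB.instance Definition _ n X :=
  GRing.isSubmodClosed.Build K (chains n X) (@is_cycle n X)
    (@is_cycle_submod n X).

Record cycles n X := Cycle { cycle_val : chains n X; _ : is_cycle cycle_val }.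

HB.instance Definition _ n X := [isSub for @cycle_val n X].
HB.instance Definition _ n X := [Choice of cycles n X by <:].
HB.instance Definition _ n X :=
  [SubChoice_isSubLmodule of cycles n X by <:].

(* By boundary_boundary, every boundary is the value of some z : cycles n X. *)
Definition is_boundary n X : {pred cycles n X} :=
  fun z => `[< exists c, boundary c = val z >].

Fact is_boundary_submod n X : submod_closed (@is_boundary n X).
Proof.
split=> [|c u v]; first by apply/asboolP; exists 0; rewrite !linear0.
move=> /asboolP[x xu] /asboolP[y yv]; apply/asboolP; exists (c *: x + y).
by rewrite !linearP /= xu yv.
Qed.

HB.instance Definition _ n X :=
  GRing.isSubmodClosed.Build K (cycles n X) (@is_boundary n X)
    (@is_boundary_submod n X).

Definition homology n X : lmodType K := quotmod (@is_boundary n X).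

Section Induced.
Variables (X Y : topologicalType) (f : continuousType X Y).

Definition chain_map n : chains n X -> chains n Y :=
  fglift (fun s : singular_simplex n X =>
    chain1 (f \o s : singular_simplex n Y)).

HB.instance Definition _ n := GRing.Linear.on (@chain_map n).

Lemma chain_map1 n (s : singular_simplex n X) :
  chain_map (chain1 s) = chain1 (f \o s : singular_simplex n Y).
Proof. by rewrite /chain_map liftU scale1r. Qed.

Lemma chain_map_boundary n (c : chains n.+1 X) :
  chain_map (boundary c) = boundary (chain_map c).
Proof.
apply: (@freeg_ext _ _ _ (@chain_map n \o @boundary n X)
  (@boundary n Y \o @chain_map n.+1)) => s /=.
rewrite -/(chain1 s) boundary1 chain_map1 boundary1 linear_sum.
apply: eq_bigr => i _; rewrite linearZ /= chain_map1; congr (_ *: chain1 _).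
exact/continuousEP.
Qed.

Lemma chain_map_cycle n (c : chains n X) : is_cycle c -> is_cycle (chain_map c).
Proof.
by case: n c => //= n c /eqP c0; rewrite -chain_map_boundary c0 linear0.
Qed.

Definition cycle_map n (z : cycles n X) : cycles n Y :=
  Cycle (chain_map_cycle (valP z)).

Fact cycle_map_is_linear n : linear (@cycle_map n).
Proof. by move=> c u v; apply: val_inj; rewrite /= !linearP. Qed.

HB.instance Definition _ n := GRing.isLinear.Build K (cycles n X) (cycles n Y) _
  (@cycle_map n) (@cycle_map_is_linear n).

Lemma cycle_map_boundary n (z : cycles n X) :
  z \in @is_boundary n X -> cycle_map z \in @is_boundary n Y.
Proof.
move=> /asboolP[c cz]; apply/asboolP; exists (chain_map c).
by rewrite -chain_map_boundary cz.
Qed.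

Definition homology_map n : {linear homology n X -> homology n Y} :=
  quotmod_map (@cycle_map_boundary n).

End Induced.

Lemma chain_map_id n X (c : chains n X) : chain_map idfun c = c.
Proof.
apply: (@freeg_ext _ _ _ (@chain_map X X idfun n) idfun) => s /=.
by rewrite -/(chain1 s) chain_map1; congr chain1; exact/continuousEP.
Qed.

Lemma chain_map_comp n (X Y Z : topologicalType) (g : continuousType Y Z)
    (f : continuousType X Y) (c : chains n X) :
  chain_map (g \o f : continuousType X Z) c = chain_map g (chain_map f c).
Proof.
apply: (@freeg_ext _ _ _ (@chain_map X Z (g \o f) n)
  (@chain_map Y Z g n \o @chain_map X Y f n)) => s /=.
by rewrite -/(chain1 s) !chain_map1; congr chain1; exact/continuousEP.
Qed.

Lemma homology_map_id n (X : topologicalType) (a : homology n X) :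
  homology_map (idfun : continuousType X X) n a = a.
Proof.
have [z <-] := quot_pr_surj a; rewrite /= quotmod_mapE; congr quot_pr.
by apply: val_inj; rewrite /= chain_map_id.
Qed.

Lemma homology_map_comp n (X Y Z : topologicalType) (g : continuousType Y Z)
    (f : continuousType X Y) (a : homology n X) :
  homology_map (g \o f : continuousType X Z) n a =
  homology_map g n (homology_map f n a).
Proof.
have [z <-] := quot_pr_surj a; rewrite /= !quotmod_mapE; congr quot_pr.
by apply: val_inj; rewrite /= chain_map_comp.
Qed.

Definition singular_homology n : vect_functor K Top := {|
  fobj := fun X : Top => homology n X;
  fmap := fun (X Y : Top) f => homology_map f n;
  fmap_id := fun X : Top => @homology_map_id n X;
  fmap_comp := fun (X Y Z : Top) g f => @homology_map_comp n X Y Z g f |}.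

End SingularHomology.

Definition finite_CW_category (R : realType) : category :=
  full_subcategory (fun X : Top => finite_CW_type R X).

Definition CW_homology (R : realType) (K : fieldType) n :
    vect_functor K (finite_CW_category R) :=
  restrict_functor _ (singular_homology R K n).

(* Main.v *)
Require Import Defs.
From HB Require Import structures.
From mathcomp Require Import all_boot all_order all_algebra.
From mathcomp Require Import all_classical all_reals ereal topology normedtype.
From mathcomp.multinomials Require Import freeg.
From mathcomp Require Import realfun zify ring lra.

(** Suprema of rescaled functorial seminorms are functorial seminorms.
    If countably many pairs (X, a) with a in F(X) generate F, and countably many
    finite seminorms t_n have the same common null space as all finite seminorms,
    then sup_n c_n t_n is universal as soon as the c_n > 0 decay fast enough to
    make it finite on every generator.

    Countability comes from topology.  Attaching cells one at a time, every
    finite CW complex embeds in some R^N as a retract of a neighbourhood of its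
    image, hence every space of the category is, up to homotopy, a retract of a
    finite union P of balls with rational centres and radii; there are countably
    many such P.  Each H_d(P) is countably spanned: on a fine grid, replacing a
    simplex by an interpolation of its rounded values is natural in faces and
    stays homotopic to the original inside the open set P, and there are
    countably many interpolation tables.  If X and Y are retracts of the same P,
    then X -> P -> Y is a morphism of the category, so seminorms can be compared
    through H_d(P), although P itself need not be in the category.  Inside the
    span of the first k generators of H_d(P), the null spaces form a directed
    family of subspaces of a finite-dimensional space, so one seminorm already
    has the smallest one. *)

Set Implicit Arguments.
Unset Strict Implicit.
Unset Printing Implicit Defensive.

Import Order.TTheory GRing.Theory Num.Theory.
Import numFieldNormedType.Exports Defs.

Local Open Scope classical_set_scope.
Local Open Scope ring_scope.

(** * Spans *)

Section Span.
Variables (K : fieldType) (V : lmodType K).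

(** An inductive predicate instead of finite sums: closure properties and images under linear maps
    follow by induction on the derivation. *)
Inductive lspan (S : set V) : V -> Prop :=
| lspan0 : lspan S 0
| lspan_cons a s v : S s -> lspan S v -> lspan S (a *: s + v).

Lemma sub_lspan S v : S v -> lspan S v.
Proof. by move=> Sv; rewrite -[v]scale1r -[_ *: _]addr0; apply: lspan_cons => //; exact: lspan0. Qed.

Lemma lspanP S a u v : lspan S u -> lspan S v -> lspan S (a *: u + v).
Proof.
move=> Su Sv; elim: Su => [|b s w Ss _ IH]; first by rewrite scaler0 add0r.
by rewrite scalerDr scalerA -addrA; apply: lspan_cons.
Qed.

Lemma lspanD S u v : lspan S u -> lspan S v -> lspan S (u + v).
Proof. by move=> Su Sv; rewrite -[u]scale1r; apply: lspanP. Qed.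

Lemma lspanZ S a u : lspan S u -> lspan S (a *: u).
Proof. by move=> Su; rewrite -[_ *: _]addr0; apply: lspanP => //; exact: lspan0. Qed.

Lemma lspanB S u v : lspan S u -> lspan S v -> lspan S (u - v).
Proof. by move=> Su Sv; rewrite addrC -scaleN1r; apply: lspanP. Qed.

Lemma lspan_sum S (I : Type) (r : seq I) (P : pred I) (F : I -> V) :
  (forall i, P i -> lspan S (F i)) -> lspan S (\sum_(i <- r | P i) F i).
Proof. by move=> SF; elim/big_ind: _ => //; [exact: lspan0|exact: lspanD]. Qed.

Lemma lspan_trans S T v : S `<=` lspan T -> lspan S v -> lspan T v.
Proof.
by move=> ST; elim=> [|a s w Ss _ Tw]; [exact: lspan0|apply: lspanP => //; exact: ST].
Qed.

Lemma lspan_finite S v : lspan S v ->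
  exists2 l : seq V, {in l, forall x, S x} & lspan [set` l] v.
Proof.
elim=> [|a s w Ss _ [l lS lw]]; first by exists [::]; [|exact: lspan0].
exists (s :: l); first by move=> x; rewrite inE => /orP[/eqP->//|/lS].
apply: lspan_cons; first by rewrite /= mem_head.
by apply: lspan_trans lw => x /= xl; apply: sub_lspan; rewrite /= inE xl orbT.
Qed.

(* [spanned_below e k] is the lspan of [e 0, ..., e k.-1]. *)
Fixpoint spanned_below (e : nat -> V) k : set V :=
  if k is k'.+1 then [set v | exists a, spanned_below e k' (v - a *: e k')]
  else [set 0].

Variable e : nat -> V.

Lemma spanned_belowP k a u v : spanned_below e k u -> spanned_below e k v ->
  spanned_below e k (a *: u + v).
Proof.
elim: k a u v => [|k IH] a u v /=; first by move=> -> ->; rewrite scaler0 addr0.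
move=> [b ub] [c vc]; exists (a * b + c).
suff -> : a *: u + v - (a * b + c) *: e k = a *: (u - b *: e k) + (v - c *: e k) by exact: IH.
by rewrite scalerDl scalerBr scalerA opprD addrACA.
Qed.

Lemma spanned_below0 k : spanned_below e k 0.
Proof. by elim: k => [//|k IH]; exists 0; rewrite scale0r subr0. Qed.

Lemma spanned_belowS k v : spanned_below e k v -> spanned_below e k.+1 v.
Proof. by exists 0; rewrite scale0r subr0. Qed.

Lemma spanned_below_leq k l v : (k <= l)%N ->
  spanned_below e k v -> spanned_below e l v.
Proof.
move=> /subnK <-; elim: (l - k)%N => [//|m IH] kv.
by rewrite addSn; apply: spanned_belowS; exact: IH.
Qed.

Lemma lspan_spanned_below v :
  lspan (range e) v -> exists k, spanned_below e k v.
Proof.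
elim=> [|a _ w [j _ <-] _ [k kw]]; first by exists 0%N.
exists (maxn j.+1 k); apply: spanned_belowP.
  apply: spanned_below_leq (leq_maxl _ _) _.
  by exists 1; rewrite scale1r subrr; exact: spanned_below0.
exact: spanned_below_leq (leq_maxr _ _) kw.
Qed.

(* An echelon basis: for each [k], pick a vector of [U] with pivot [e k]. *)
Lemma countable_lspan_subset (S : set V) : (forall v, S v -> lspan (range e) v) ->
  exists2 f : nat -> V, (forall j, f j = 0 \/ S (f j)) &
    forall v, S v -> lspan (range f) v.
Proof.
move=> eT; pose pivot k v := lspan S v /\ spanned_below e k (v - e k).
have /choice[p pP] : forall k, exists v, lspan S v /\
    forall u, pivot k u -> pivot k v.
  (* If no vector of the span has pivot [e k], the default 0 still lies in the span. *)
  move=> k; have [[u uk]|noU] := pselect (exists u, pivot k u).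
    by exists u; split => //; case: uk.
  exists 0; split; first exact: lspan0.
  by move=> u uk; case: noU; exists u.
have pS k v : lspan S v -> spanned_below e k v -> lspan (range p) v.
  elim: k v => [|k IH] v Sv /=; first by move=> ->; exact: lspan0.
  move=> [a va]; have [a0|a0] := eqVneq a 0.
    by apply: IH => //; move: va; rewrite a0 scale0r subr0.
  (* Gaussian elimination: a nonzero coefficient [a] of [e k] makes [a^-1 *: v] a pivot vector, so
     [p k] is one too, and subtracting [a *: p k] lowers the index. *)
  have kv : pivot k (a^-1 *: v).
    split; first exact: lspanZ.
    rewrite (_ : _ - _ = a^-1 *: (v - a *: e k) + 0); last first.
      by rewrite addr0 scalerBr scalerA mulVf // scale1r.
    by apply: spanned_belowP => //; exact: spanned_below0.
  have [Spk pk] := (pP k).2 _ kv.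
  rewrite -[v](subrK (a *: p k)); apply: lspanD; last first.
    by apply: lspanZ; apply: sub_lspan; exists k.
  apply: IH; first by apply: lspanB => //; exact: lspanZ.
  rewrite (_ : _ - _ = (- a) *: (p k - e k) + (v - a *: e k)).
    exact: spanned_belowP.
  by rewrite scaleNr scalerBr opprB [RHS]addrC addrA subrK.
(* The [p k] lie only in the span of [S]. Each involves finitely many members of [S], and [f]
   enumerates all of these, padded with 0. *)
have /choice[l lP] : forall k, exists l : seq V,
    {in l, forall x, S x} /\ lspan [set` l] (p k).
  by move=> k; have [l lS kl] := lspan_finite (pP k).1; exists l.
pose f m := if unpickle m is Some (k, j) then nth 0 (l k) j else 0.
exists f => [m|v Sv].
  rewrite /f; case: unpickle => [[k j]|]; last by left.
  have [jl|jl] := ltnP j (size (l k)); last by left; rewrite nth_default.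
  by right; apply: (lP k).1; exact: mem_nth.
have [k kv] := lspan_spanned_below (eT v Sv).
apply: lspan_trans (pS k v (sub_lspan Sv) kv) => _ [j _ <-].
apply: lspan_trans (lP j).2 => x /= xl; apply: sub_lspan.
exists (pickle (j, index x (l j))) => //.
by rewrite /f pickleK nth_index.
Qed.

(* If some [N t] has no vector with pivot [e k] then [N t] is cut down to the
   lspan of [e 0, ..., e k.-1]; otherwise pivots can be subtracted in each [N t]. *)
Lemma directed_subspaces_min (T : Type) (N : T -> set V) (t0 : T) k :
  (forall t, N t 0) ->
  (forall t a u v, N t u -> N t v -> N t (a *: u + v)) ->
  (forall t t', exists u, N u `<=` N t `&` N t') ->
  exists t, forall v, spanned_below e k v -> N t v -> forall t', N t' v.
Proof.
move=> N0 NP Ndir; elim: k => [|k [t1 t1P]]; first by exists t0 => _ ->.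
have [[t2 t2P]|npiv] := pselect (exists t, forall v,
    spanned_below e k (v - e k) -> ~ N t v).
  have [t tN] := Ndir t1 t2; exists t => v [a va] tv t'.
  have [a0|a0] := eqVneq a 0.
    move: va; rewrite a0 scale0r subr0 => va.
    by apply: (t1P v) => //; have [] := tN _ tv.
  exfalso; apply: (t2P (a^-1 *: v)); last first.
    by rewrite -[_ *: v]addr0; apply: NP => //; have [] := tN _ tv.
  rewrite (_ : _ - _ = a^-1 *: (v - a *: e k) + 0).
    by apply: spanned_belowP => //; exact: spanned_below0.
  by rewrite addr0 scalerBr scalerA mulVf // scale1r.
exists t1 => v [a va] t1v t'.
have [t tN] := Ndir t1 t'.
have [w [wk tw]] : exists w, spanned_below e k (w - e k) /\ N t w.
  apply: contrapT => nw; apply: npiv; exists t => w wk tw.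
  by apply: nw; exists w.
have [t1w t'w] := tN _ tw.
suff : N t' (v - a *: w) by move=> h; rewrite -[v](subrK (a *: w)) addrC; exact: NP.
apply: (t1P (v - a *: w)); last by rewrite addrC -scaleNr; exact: NP.
rewrite (_ : _ - _ = (- a) *: (w - e k) + (v - a *: e k)); last first.
  by rewrite scaleNr scalerBr opprB [RHS]addrC addrA subrK.
exact: spanned_belowP.
Qed.
End Span.

Lemma lspan_image (K : fieldType) (V W : lmodType K) (f : {linear V -> W})
  (S : set V) v : lspan S v -> lspan (f @` S) (f v).
Proof.
elim=> [|a s w Ss _ IH]; first by rewrite linear0; exact: lspan0.
by rewrite linearP; apply: lspan_cons => //; exists s.
Qed.

(** * Suprema of rescaled functorial seminorms *)

Section FsnSup.
Variables (R : realType) (K : fieldType) (nrm : field_norm R K).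
Variables (C : category) (F : vect_functor K C).
Local Notation fsn := (functorial_seminorm nrm F).
Local Open Scope ereal_scope.

Section Sup.
Variables (I : Type) (i0 : I) (c : I -> R) (t : I -> fsn).
Hypothesis c_ge0 : forall i, (0 <= c i)%R.

Let supv (X : C) (a : F X) := ereal_sup (range (fun i => (c i)%:E * t i X a)).

Let supv_ub X (a : F X) i : (c i)%:E * t i X a <= supv a.
Proof. by apply: ereal_sup_ubound; exists i. Qed.

(** The index [i0] enters here: the supremum of an empty family would be [-oo]. *)
Let supv_ge0 X (a : F X) : 0 <= supv a.
Proof.
apply: le_trans (supv_ub a i0).
by rewrite mule_ge0 // ?lee_fin //; exact: sn_ge0.
Qed.

Let supv0 X : supv (0%R : F X) = 0.
Proof.
apply/eqP; rewrite eq_le supv_ge0 andbT; apply/ereal_supP => _ [i _ <-].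
by rewrite sn0 mule0.
Qed.

Let supvD X (a b : F X) : supv (a + b)%R <= supv a + supv b.
Proof.
apply/ereal_supP => _ [i _ <-].
apply: le_trans (leeD (supv_ub a i) (supv_ub b i)).
rewrite -ge0_muleDr ?sn_ge0 //; apply: lee_pmul => //; rewrite ?lee_fin //.
  exact: sn_ge0.
exact: snD.
Qed.

Let supvZ X x (a : F X) : x != 0%R -> supv (x *: a)%R = (nrm x)%:E * supv a.
Proof.
move=> x0; rewrite /supv -ereal_supZl ?fnorm_ge0 //; last first.
  by apply/set0P; exists ((c i0)%:E * t i0 X a), i0.
rewrite image_comp; congr ereal_sup; apply: eq_imagel => i _ /=.
by rewrite snZ // muleCA.
Qed.

Let supv_le X Y (f : hom X Y) (a : F X) : supv (fmap F f a) <= supv a.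
Proof.
apply/ereal_supP => _ [i _ <-]; apply: le_trans (supv_ub a i).
apply: lee_pmul => //; rewrite ?lee_fin //; first exact: sn_ge0.
exact: fsn_le.
Qed.

Definition fsn_sup : fsn := FunctorialSeminorm (fsn := fun X =>
  Seminorm (@supv_ge0 X) (@supv0 X) (@supvD X) (@supvZ X)) supv_le.

Lemma fsn_supE X (a : F X) :
  fsn_sup X a = ereal_sup (range (fun i => (c i)%:E * t i X a)).
Proof. by []. Qed.

Lemma fsn_sup_ub X (a : F X) i : (c i)%:E * t i X a <= fsn_sup X a.
Proof. exact: supv_ub. Qed.

Lemma fsn_sup_eq0 X (a : F X) i : (0 < c i)%R ->
  fsn_sup X a = 0 -> t i X a = 0.
Proof.
move=> ci a0; apply/eqP; rewrite eq_le sn_ge0 andbT.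
have := fsn_sup_ub a i; rewrite a0 => h.
by rewrite -(@lee_pmul2l _ (c i)%:E) ?lte_fin // mule0.
Qed.
End Sup.

Definition sn_zero (V : lmodType K) : seminorm nrm V.
Proof.
apply: (@Seminorm R K nrm V (fun=> 0)) => //; first by move=> x y; rewrite adde0.
by move=> a x _; rewrite mule0.
Defined.

Definition fsn_zero : fsn.
Proof. by apply: (@FunctorialSeminorm _ _ _ _ _ (fun X => sn_zero (F X))). Defined.

Lemma finite_fsn_zero : finite_fsn fsn_zero.
Proof. by []. Qed.

Lemma finite_fsn_fin_num (t : fsn) : finite_fsn t ->
  forall X (a : F X), t X a \is a fin_num.
Proof.
move=> tfin X a; rewrite ge0_fin_numE ?sn_ge0 // ltey; exact/eqP/tfin.
Qed.

Lemma sn_finP (t : fsn) X (a b : F X) x :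
  t X a < +oo -> t X b < +oo -> t X (x *: a + b)%R < +oo.
Proof.
move=> ta tb; apply: le_lt_trans (snD _ _ _) _; apply: lte_add_pinfty => //.
have [->|x0] := eqVneq x 0%R; first by rewrite scale0r sn0 ltey.
by rewrite snZ // lte_mul_pinfty // ?lee_fin ?fnorm_ge0.
Qed.

Lemma sn_nullP (t : fsn) X (a b : F X) x :
  t X a = 0 -> t X b = 0 -> t X (x *: a + b)%R = 0.
Proof.
move=> ta tb; apply/eqP; rewrite eq_le sn_ge0 andbT.
apply: le_trans (snD _ _ _) _; rewrite tb adde0.
have [->|x0] := eqVneq x 0%R; first by rewrite scale0r sn0.
by rewrite snZ // ta mule0.
Qed.
End FsnSup.

(** * A universal seminorm from countability *)

Section Universal.
Variables (R : realType) (K : fieldType) (nrm : field_norm R K).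
Variables (C : category) (F : vect_functor K C).
Local Notation fsn := (functorial_seminorm nrm F).
Variables (I : countType) (W : I -> lmodType K) (e : forall p, nat -> W p).
Hypothesis eT : forall p v, lspan (range (e p)) v.
(** In the application [W p] is the homology of the open set coded by [p], and [i], [r] are induced
    by continuous maps that make [X] a homotopy retract of it. *)
Variable retract : forall p (X : C), {linear F X -> W p} -> {linear W p -> F X} -> Prop.
Hypothesis retractK : forall p X i r, @retract p X i r -> cancel i r.
Hypothesis retract_hom : forall p X Y i r i' r', @retract p X i r ->
  @retract p Y i' r' -> exists f : hom X Y, forall a, fmap F f a = r' (i a).
Hypothesis retract_ex : forall X, exists p i r, @retract p X i r.

(** For each [p] the vectors [i a], over all spaces [X], lie in a countably spanned space, so
    countably many of them span the others. Applying [r] turns each chosen one into the image of a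
    fixed class under a morphism. [None] marks the indices without a class. *)
Lemma countably_many_generators : exists g : nat -> option {X : C & F X},
  forall X (a : F X), lspan [set v | exists n Z (f : hom (projT1 Z) X),
    g n = Some Z /\ v = fmap F f (projT2 Z)] a.
Proof.
pose S p : set (W p) := [set w | exists X i r (a : F X), @retract p X i r /\ w = i a].
pose f p := cid2 (countable_lspan_subset (S := S p) (fun v _ => @eT p v)).
pose Q (q : I * nat) (z : option {X : C & F X}) := if z is Some Z then
  exists i r, @retract q.1 (projT1 Z) i r /\ s2val (f q.1) q.2 = i (projT2 Z)
  else s2val (f q.1) q.2 = 0.
have /choice[z zQ] : forall q, exists z, Q q z.
  move=> [p j]; case: (s2valP (f p) j) => [f0|[X [i [r [a [ir fa]]]]]].
    by exists None.
  by exists (Some (existT _ X a)), i, r.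
exists (fun n => obind z (unpickle n)) => X a.
have [p [i [r ir]]] := retract_ex X.
rewrite -[a](retractK ir).
have Sa : S p (i a) by exists X, i, r, a.
apply: lspan_trans (lspan_image r (s2valP' (f p) _ Sa)) => _ [_ [j _ <-] <-].
have := zQ (p, j); rewrite /Q /=; case E : (z (p, j)) => [Z|]; last first.
  by move=> ->; rewrite linear0; exact: lspan0.
move=> [i' [r' [ir' ->]]]; apply: sub_lspan.
have [h hE] := retract_hom ir' ir.
by exists (pickle (p, j)), Z, h; rewrite pickleK /= E hE.
Qed.

(** The subspaces [null p t] of [W p] are directed, so on the span of the first [k] generators one
    seminorm has the smallest. These choices, over all [(p, k)], form the family. *)
Lemma countably_many_detecting : exists t : I * nat -> fsn,
  (forall q, finite_fsn (t q)) /\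
  forall s : fsn, finite_fsn s -> forall X (a : F X),
    (forall q, t q X a = 0%E) -> s X a = 0%E.
Proof.
pose null p (t : {t : fsn | finite_fsn t}) (w : W p) :=
  forall Y i r, @retract p Y i r -> sval t Y (r w) = 0%E.
pose t0 : {t : fsn | finite_fsn t} := exist _ _ (@finite_fsn_zero R K nrm C F).
have /choice[t tP] : forall q : I * nat, exists t, forall w,
    spanned_below (@e q.1) q.2 w -> null q.1 t w -> forall t', null q.1 t' w.
  move=> [p k] /=; apply: directed_subspaces_min => //.
  - by move=> t Y i r _; rewrite linear0 sn0.
  - move=> t a u v tu tv Y i r ir; rewrite linearP; apply: sn_nullP.
      exact: tu ir.
    exact: tv ir.
  - move=> [t tf] [t' t'f].
    (* The pointwise maximum of two seminorms vanishes only where both do. *)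
    pose s := @fsn_sup R K nrm C F bool true (fun=> 1)
      (fun b => if b then t else t') (fun=> ler01).
    have sf : finite_fsn s.
      move=> X a; rewrite fsn_supE; apply/eqP; rewrite -ltey.
      apply: le_lt_trans (_ : t X a + t' X a < +oo)%E; last first.
        by rewrite lte_add_pinfty // ltey; exact/eqP.
      apply/ereal_supP => _ [[] _ <-]; rewrite mul1e.
        by rewrite leeDl // sn_ge0.
      by rewrite leeDr // sn_ge0.
    exists (exist _ s sf) => w sw; split=> Y i r ir /=.
      exact: (@fsn_sup_eq0 _ _ _ _ _ _ _ _ _ _ _ _ true ltr01 (sw Y i r ir)).
    exact: (@fsn_sup_eq0 _ _ _ _ _ _ _ _ _ _ _ _ false ltr01 (sw Y i r ir)).
exists (fun q => sval (t q)); split=> [q|s sf X a ta]; first exact: (svalP (t q)).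
have [p [i [r ir]]] := retract_ex X.
have [k ik] := lspan_spanned_below (@eT p (i a)).
rewrite -[a](retractK ir).
apply: (tP (p, k) (i a) ik _ (exist _ s sf) X i r ir) => /= Y i' r' ir'.
(* Membership of [i a] in [null] concerns every retract [Y]. Since [r' (i a)] is the image of [a]
   under a morphism, the vanishing of the seminorm at [a] is enough. *)
have [f <-] := retract_hom ir ir'.
apply/eqP; rewrite eq_le sn_ge0 andbT -(ta (p, k)); exact: fsn_le.
Qed.

(* A countable family of finite functorial seminorms, rescaled so that on each
   generator all but finitely many members are at most 1, has a finite supremum. *)
Theorem universal_finite_fsn_ex :
  exists s : fsn, universal_finite_fsn s.
Proof.
have [g gen] := countably_many_generators.
have [t [tfin tdet]] := countably_many_detecting.
(* With no index at all, [tdet] makes every finite seminorm vanish, so the zero seminorm is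
   universal. *)
have [[q0 _]|noq] := pselect (exists q0 : I * nat, True); last first.
  exists (fsn_zero nrm F); split=> // s sf X a _.
  by apply: (tdet s sf) => q; case: noq; exists q.
pose val q m : R := if g m is Some Z then fine (t q _ (projT2 Z)) else 0.
have val_ge0 q m : 0 <= val q m.
  by rewrite /val; case: (g m) => // Z; rewrite fine_ge0 // sn_ge0.
(* Chosen so that [c q * val q m <= 1] as soon as [m <= pickle q]; the summand 1 gives
   [c q <= 1]. *)
pose c q : R := (1 + \sum_(m < (pickle q).+1) val q m)^-1.
have c1 q : 1 <= 1 + \sum_(m < (pickle q).+1) val q m.
  by rewrite lerDl sumr_ge0.
have c_gt0 q : 0 < c q by rewrite invr_gt0 (lt_le_trans ltr01).
have c_ge0 q : 0 <= c q by exact: ltW.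
pose s := @fsn_sup R K nrm C F _ q0 c t c_ge0.
exists s; split; last first.
  move=> u uf X a sa; apply: (tdet u uf) => q.
  exact: (@fsn_sup_eq0 _ _ _ _ _ _ _ _ _ _ _ _ q (c_gt0 q) sa).
suff fin X (a : F X) : (s X a < +oo)%E by move=> X a; apply/eqP; rewrite -ltey.
elim: (gen X a) => [|x _ v [m [Z [f [gm ->]]]] _]; first by rewrite sn0 ltey.
apply: sn_finP; apply: le_lt_trans (fsn_le _ _ _) _.
(* For the [m]-th generator only the finitely many [q] with [pickle q < m] can exceed 1, and the sum
   dominates those. *)
pose B : R := 1 + \sum_(n < m) (if unpickle n is Some q then val q m else 0).
apply: le_lt_trans (_ : (B%:E < +oo)%E); last by rewrite ltey.
rewrite fsn_supE; apply/ereal_supP => _ [q _ <-].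
have -> : t q _ (projT2 Z) = (val q m)%:E.
  by rewrite /val gm fineK // finite_fsn_fin_num.
rewrite -EFinM lee_fin mulrC ler_pdivrMr ?(lt_le_trans ltr01) //.
have B1 : 1 <= B.
  by rewrite lerDl sumr_ge0 // => n _; case: unpickle.
have [qm|mq] := ltnP (pickle q) m.
  apply: le_trans (_ : B <= _); last by rewrite ler_peMr ?(le_trans ler01).
  rewrite /B (bigD1 (Ordinal qm)) //= pickleK addrCA lerDl addr_ge0 //.
  by rewrite sumr_ge0 // => n _; case: unpickle.
apply: le_trans (_ : 1 + \sum_(m < (pickle q).+1) val q m <= _); last first.
  by rewrite ler_peMl // (le_trans ler01).
rewrite (bigD1 (Ordinal (mq : (m < (pickle q).+1)%N))) //= addrCA lerDl addr_ge0 //.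
by rewrite sumr_ge0.
Qed.

End Universal.

(** * Prism operator *)

Section Topology.
Variable R : realType.

Lemma continuous_at_row (T : topologicalType) n (f : T -> 'rV[R]_n) x :
  (forall j, {for x, continuous (fun y => f y ord0 j)}) ->
  {for x, continuous f}.
Proof.
move=> cf A [P nP sPA].
have : \forall y \near x, forall j, P ord0 j (f y ord0 j).
  by apply: (@filter_forall _ _ _ (nbhs x)) => j; exact: (cf j _ (nP ord0 j)).
by apply: filterS => y yP; apply: sPA => a j; rewrite (ord1 a); exact: yP.
Qed.

Lemma continuous_row (T : topologicalType) n (f : T -> 'rV[R]_n) :
  (forall j, continuous (fun y => f y ord0 j)) -> continuous f.
Proof. by move=> cf x; apply: continuous_at_row => j; exact: cf. Qed.

Lemma coord_row_continuous n j : continuous (fun t : 'rV[R]_n => t ord0 j).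
Proof. by move=> u; exact: (@coord_continuous R 1 n ord0 j). Qed.

Lemma set_val_continuous (X : topologicalType) (A : set X) :
  continuous (val : A -> X).
Proof. exact: initial_continuous. Qed.

Lemma coord_val_continuous n (A : set 'rV[R]_n) j :
  continuous (fun t : A => val t ord0 j).
Proof.
move=> t; apply: (@continuous_comp A 'rV[R]_n R val (fun u => u ord0 j)).
  exact: set_val_continuous.
exact: coord_row_continuous.
Qed.

Lemma continuous_at_pair (T X Y : topologicalType) (f : T -> X) (g : T -> Y) x :
  {for x, continuous f} -> {for x, continuous g} ->
  {for x, continuous (fun y => (f y, g y))}.
Proof. by move=> cf cg; exact: (cvg_pair cf cg). Qed.

Lemma continuous_set_type (T X : topologicalType) (A : set X) (f : T -> A) :
  continuous (val \o f) -> continuous f.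
Proof. by move=> cf; exact: continuous_comp_initial. Qed.

Lemma continuous_sum (T : topologicalType) (I : Type) (r : seq I) (P : pred I)
  (f : I -> T -> R) : (forall i, P i -> continuous (f i)) ->
  continuous (fun x => \sum_(i <- r | P i) f i x).
Proof.
by move=> cf; apply: continuous_big => //; exact: add_continuous.
Qed.
End Topology.

(** * Affine maps between simplices and into cylinders *)

Section Push.
Variable R : realType.

(** In barycentric coordinates, the affine map that sends vertex [j] to vertex [phi j]. Identities
    between such maps reduce to identities of index functions. *)
Definition push_row m n (phi : 'I_m.+1 -> 'I_n.+1) (t : 'rV[R]_m.+1) :
  'rV[R]_n.+1 := \row_k \sum_(j | phi j == k) t ord0 j.

Lemma push_row_comp l m n (psi : 'I_m.+1 -> 'I_n.+1) (phi : 'I_l.+1 -> 'I_m.+1) t :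
  push_row psi (push_row phi t) = push_row (psi \o phi) t.
Proof.
apply/rowP => k; rewrite !mxE.
rewrite [RHS](partition_big phi (fun j => psi j == k)) //=.
apply: eq_bigr => j /eqP <-; rewrite mxE; apply: eq_bigl => i.
by rewrite andbC; case: (eqVneq (phi i) j) => //= ->; rewrite eqxx.
Qed.

Lemma face_row_push n (i : 'I_n.+2) t :
  face_row i t = push_row (fintype.lift i) t.
Proof.
apply/rowP => k; case: (unliftP i k) => [j|] ->; rewrite ?face_rowE ?face_row0 mxE.
  by rewrite (big_pred1 j) // => l; rewrite (inj_eq (@lift_inj _ _)).
by rewrite big_pred0 // => l; rewrite eq_sym (negPf (neq_lift _ _)).
Qed.

Lemma sum_push_row m n (phi : 'I_m.+1 -> 'I_n.+1) (b : pred 'I_n.+1) t :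
  \sum_(k | b k) push_row phi t ord0 k = \sum_(j | b (phi j)) t ord0 j.
Proof.
rewrite [RHS](partition_big phi b) //=; apply: eq_bigr => k bk.
rewrite mxE; apply: eq_bigl => j.
by case: (eqVneq (phi j) k) => [->|]; rewrite ?bk ?andbF.
Qed.

Lemma push_row_simplex m n (phi : 'I_m.+1 -> 'I_n.+1) (t : simplex R m) :
  push_row phi (val t) \in simplex R n.
Proof.
case: t => t /= /[!inE] -[t0 t1]; split=> [j|].
  by rewrite mxE sumr_ge0.
rewrite -t1 (partition_big phi xpredT) //=.
by apply: eq_bigr => k _; rewrite mxE.
Qed.

Definition push m n (phi : 'I_m.+1 -> 'I_n.+1) (t : simplex R m) : simplex R n :=
  exist _ (push_row phi (val t)) (push_row_simplex phi t).

Lemma push_continuous m n (phi : 'I_m.+1 -> 'I_n.+1) : continuous (push phi).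
Proof.
apply: continuous_set_type; apply: continuous_row => k.
rewrite [X in continuous X](_ : _ = fun t : simplex R m => \sum_(j | phi j == k) val t ord0 j); last first.
  by apply/funext => t; rewrite /= mxE.
apply: continuous_sum => j _; exact: coord_val_continuous.
Qed.

Lemma push_comp l m n (psi : 'I_m.+1 -> 'I_n.+1) (phi : 'I_l.+1 -> 'I_m.+1) t :
  push psi (push phi t) = push (psi \o phi) t.
Proof. by apply: val_inj; exact: push_row_comp. Qed.

Lemma face_push n (i : 'I_n.+2) (t : simplex R n) :
  face_fun i t = push (fintype.lift i) t.
Proof. by apply: val_inj; exact: face_row_push. Qed.

Lemma push_id n (t : simplex R n) : push id t = t.
Proof.
by apply: val_inj; apply/rowP => k; rewrite mxE (big_pred1 k).
Qed.

(* The affine map from the [m]-simplex to the cylinder over the [n]-simplex that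
   sends the vertex [j] to [(phi j, b j)]. *)
Definition cyl_map m n (phi : 'I_m.+1 -> 'I_n.+1) (b : pred 'I_m.+1)
  (t : simplex R m) : simplex R n * R := (push phi t, \sum_(j | b j) val t ord0 j).

Lemma cyl_map_continuous m n phi b : continuous (@cyl_map m n phi b).
Proof.
move=> t; apply: continuous_at_pair; first exact: push_continuous.
by apply: continuous_sum => j _; exact: coord_val_continuous.
Qed.

HB.instance Definition _ m n phi b := isContinuous.Build (simplex R m)
  (simplex R n * R)%type (@cyl_map m n phi b) (@cyl_map_continuous m n phi b).

Lemma eq_cyl_map m n phi phi' b b' : phi =1 phi' -> b =1 b' ->
  @cyl_map m n phi b =1 cyl_map phi' b'.
Proof.
move=> ep eb t; congr pair; last exact: eq_bigl.
apply: val_inj; apply/rowP => k; rewrite !mxE; apply: eq_bigl => j.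
by rewrite ep.
Qed.

Lemma cyl_map_face m n phi b i t :
  @cyl_map m.+1 n phi b (face_fun i t) =
  cyl_map (phi \o fintype.lift i) (b \o fintype.lift i) t.
Proof.
by rewrite /cyl_map face_push push_comp sum_push_row.
Qed.

Lemma face_cyl_map m n phi b i t :
  (face_fun i (@cyl_map m n phi b t).1, (cyl_map phi b t).2) =
  cyl_map (fintype.lift i \o phi) b t.
Proof. by rewrite /cyl_map /= face_push push_comp. Qed.

End Push.

Section Prism.
Variables (R : realType) (K : fieldType) (Y : topologicalType).
(** The second factor is the whole line, which avoids a subspace topology; homotopies over the unit
    interval are extended to it by [clamp]. *)
Local Notation cylinder n := (continuousType (simplex R n * R)%type Y).
Local Notation chain1 := (@chain1 R K _ _).

Definition cyl_end n (h : cylinder n) (b : bool) : singular_simplex R n Y :=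
  h \o cyl_map id (fun=> b).

Lemma cyl_endE n (h : cylinder n) (b : bool) t :
  cyl_end h b t = h (t, b%:R).
Proof.
rewrite /cyl_end /= /cyl_map push_id; congr (h (_, _)).
case: b; last by rewrite big_pred0.
by case: t => t /= /[!inE] -[].
Qed.

Definition pface_fun n (i : 'I_n.+2) (x : simplex R n * R) : simplex R n.+1 * R :=
  (face_fun i x.1, x.2).

Lemma pface_continuous n (i : 'I_n.+2) : continuous (pface_fun i).
Proof.
move=> x; apply: (@continuous_at_pair _ _ _ (fun x => face_fun i x.1) snd);
  last exact: cvg_snd.
apply: (@continuous_comp _ _ _ fst (@face_fun R n i)); first exact: cvg_fst.
exact: face_continuous.
Qed.

HB.instance Definition _ n (i : 'I_n.+2) := isContinuous.Build
  (simplex R n * R)%type (simplex R n.+1 * R)%type (pface_fun i)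
  (@pface_continuous n i).

Definition cyl_face n (h : cylinder n.+1) i : cylinder n := h \o pface_fun i.

(** The degeneracy that takes the value [i] twice, at [i] and [i.+1]. *)
Definition degen n (i : 'I_n.+1) (j : 'I_n.+2) : 'I_n.+1 := inord (unbump i j).

Lemma val_degen n (i : 'I_n.+1) (j : 'I_n.+2) : degen i j = unbump i j :> nat.
Proof. by rewrite /degen inordK // /unbump; move: (ltn_ord i) (ltn_ord j); lia. Qed.

(** The usual triangulation: the [i]-th simplex has vertices (0,0), ..., (i,0), (i,1), ...,
    (n,1). *)
Definition prism n (h : cylinder n) : chains R K n.+1 Y :=
  \sum_(i < n.+1) (-1) ^+ i *:
    chain1 (h \o cyl_map (degen i) (fun j => (i < j)%N)).

(** The walls between consecutive simplices of the prism; the extreme ones, [k = 0] and [k = n.+1],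
    are its two ends. *)
Let D n (h : cylinder n) (k : nat) : chains R K n Y :=
  chain1 (h \o cyl_map id (fun j => (k <= j)%N)).

Let G n (h : cylinder n) (i : 'I_n.+1) (j : 'I_n.+2) : chains R K n Y :=
  chain1 (h \o cyl_map (degen i \o fintype.lift j)
    ((fun j => (i < j)%N) \o fintype.lift j)).

Lemma eq_chain1_cyl m n (h : cylinder n) phi phi' b b' : phi =1 phi' -> b =1 b' ->
  chain1 (h \o @cyl_map R m n phi b : singular_simplex R m Y) =
  chain1 (h \o cyl_map phi' b' : singular_simplex R m Y).
Proof.
by move=> ep eb; congr chain1; apply/continuousEP => t /=; rewrite (eq_cyl_map ep eb).
Qed.

(** Faces [i] and [i.+1] of the [i]-th simplex are the walls [D h i] and [D h i.+1] with opposite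
    signs; their sum telescopes to the two ends. *)
Lemma boundary_prism_aux n (h : cylinder n) : boundary (prism h) =
  chain1 (cyl_end h true) - chain1 (cyl_end h false) +
  \sum_(i < n.+1) \sum_(j < n.+2 | (j != i :> nat) && (j != i.+1 :> nat))
    (-1) ^+ (i + j) *: G h i j.
Proof.
have -> : boundary (prism h) = \sum_(i < n.+1) \sum_(j < n.+2)
    (-1) ^+ (i + j) *: G h i j.
  rewrite linear_sum; apply: eq_bigr => i _.
  rewrite linearZ /= boundary1 scaler_sumr; apply: eq_bigr => j _.
  rewrite scalerA -exprD; congr (_ *: chain1 _); apply/continuousEP => t /=.
  by rewrite cyl_map_face.
have -> : chain1 (cyl_end h true) - chain1 (cyl_end h false) =
    \sum_(i < n.+1) (D h i - D h i.+1).
  transitivity (D h 0 - D h n.+1).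
    congr (_ - _); apply: eq_chain1_cyl => // j /=.
    by rewrite leqNgt ltn_ord.
  rewrite -(big_mkord xpredT (fun i => D h i - D h i.+1)).
  rewrite (@telescope_sumr_eq _ _ _ (fun k => - D h k)) //.
    by rewrite opprK addrC.
  by move=> k _; rewrite opprK addrC.
rewrite -big_split /=; apply: eq_bigr => i _.
have lt1 : (i < n.+2)%N by move: (ltn_ord i); lia.
rewrite (bigD1 (Ordinal lt1)) //= (bigD1 (Ordinal (ltn_ord i : i.+1 < n.+2)%N)) /=;
  last by rewrite -val_eqE /=; lia.
rewrite addrA; congr (_ + _).
rewrite addnn -signr_odd odd_double scale1r.
rewrite addnS addnn -signr_odd /= odd_double expr1 scaleN1r; congr (_ - _).
  apply: eq_chain1_cyl => l /=.
    by apply: val_inj; rewrite /= val_degen /= /bump /unbump; lia.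
  by rewrite /bump; lia.
apply: eq_chain1_cyl => l /=.
  by apply: val_inj; rewrite /= val_degen /= /bump /unbump; lia.
by rewrite /bump; lia.
Qed.

Lemma boundary_prism0 (h : cylinder 0) : boundary (prism h) =
  chain1 (cyl_end h true) - chain1 (cyl_end h false).
Proof.
rewrite boundary_prism_aux [X in _ + X]big1 ?addr0 // => i _.
rewrite big1 // => j; case: i j => [[|i]//= lti] [[|[|j]]//= ltj].
Qed.

Lemma boundary_prismS n (h : cylinder n.+1) : boundary (prism h) =
  chain1 (cyl_end h true) - chain1 (cyl_end h false) -
  \sum_(k < n.+2) (-1) ^+ k *: prism (cyl_face h k).
Proof.
rewrite boundary_prism_aux; congr (_ + _).
rewrite pair_big_dep /= -sumrN.
under [RHS]eq_bigr => k _ do rewrite scaler_sumr -sumrN.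
rewrite pair_big /=.
(* The [i]-th simplex of the prism over face [k] is a face of a simplex of the whole prism:
   [f (k, i)] gives that simplex and the face index, and [g] inverts [f]. The two indices add up to
   [k + i + 1], whence the minus sign. *)
pose f (q : 'I_n.+2 * 'I_n.+1) : 'I_n.+2 * 'I_n.+3 :=
  (fintype.lift q.1 q.2, fintype.lift (inord q.2.+1) q.1).
pose g (p : 'I_n.+2 * 'I_n.+3) : 'I_n.+2 * 'I_n.+1 :=
  (inord (unbump p.1 p.2), inord (p.1 - (p.2 < p.1))).
have fE q : ((f q).1 = q.2 + (q.1 <= q.2) :> nat)%N /\
    ((f q).2 = q.1 + (q.2 < q.1) :> nat)%N.
  case: q => k i; rewrite /= /bump inordK; last by move: (ltn_ord i); lia.
  by split; lia.
rewrite (reindex_onto f g); last first.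
  move=> [i j] /= /andP[ji ji1].
  have [ltk lti] : (unbump i j < n.+2)%N /\ (i - (j < i) < n.+1)%N.
    by rewrite /unbump; move: (ltn_ord i) (ltn_ord j); lia.
  have [e1 e2] := fE (g (i, j)).
  rewrite -[LHS]/(f (g (i, j))) [LHS]surjective_pairing; congr (_, _); apply: ord_inj.
    by rewrite e1 /= !inordK // /unbump; lia.
  by rewrite e2 /= !inordK // /unbump; lia.
have gf q : g (f q) = q.
  have [e1 e2] := fE q; rewrite /g e1 e2; case: q {e1 e2} => k i.
  congr (_, _); apply: ord_inj; rewrite /= inordK //= /unbump;
    move: (ltn_ord i) (ltn_ord k); lia.
rewrite (eq_bigl xpredT); last first.
  move=> q; rewrite gf eqxx andbT; have [-> ->] := fE q.
  move: (nat_of_ord q.1) (nat_of_ord q.2) => k i.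
  by apply/andP; split; apply/eqP; case: (leqP k i) => ki /=; lia.
apply: eq_bigr => q _; have := fE q; move: (f q) => [i' j'] [/= e1 e2].
rewrite scalerA -exprD.
have -> : (i' + j' = (q.1 + q.2).+1)%N by rewrite e1 e2; move: (nat_of_ord q.1) (nat_of_ord q.2) => k i;
    case: (leqP k i) => /=; lia.
rewrite exprS mulN1r scaleNr; congr (- (_ *: _)).
rewrite /G; transitivity (chain1 (h \o cyl_map (fintype.lift q.1 \o degen q.2)
  (fun j => (q.2 < j)%N) : singular_simplex R n.+1 Y)); last first.
  by congr chain1; apply/continuousEP => t /=; rewrite -face_cyl_map.
apply: eq_chain1_cyl => l; last by rewrite /= e1 /bump e2; lia.
by apply: val_inj; rewrite /= !val_degen /= e1 /bump e2 /unbump; lia.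
Qed.

End Prism.

(** * Homotopy invariance *)

(** Unlike in [freeg_ext], agreement is tested only on the simplices of one chain, because the
    homotopies below respect faces only for some simplices. *)
Lemma freeg_ext_dom (K : fieldType) (T : choiceType) (V : lmodType K)
    (f g : {linear {freeg T / K} -> V}) (c : {freeg T / K}) :
  {in dom c, forall x, f (Freeg [:: (1, x)]) = g (Freeg [:: (1, x)])} -> f c = g c.
Proof.
move=> fg; rewrite -[c]freeg_sumE !linear_sum; apply: eq_big_seq => x xc.
suff -> : Freeg [:: (coeff x c, x)] = coeff x c *: Freeg [:: (1, x)].
  by rewrite !linearZ /= fg.
by apply/eqP/freeg_eqP => y; rewrite coeffZ !coeffU mul1r.
Qed.

Lemma homology_eqP (R : realType) (K : fieldType) n (X : topologicalType)
  (z z' : cycles R K n X) :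
  (exists c, boundary c = val z - val z') ->
  quot_pr (@is_boundary R K n X) z = quot_pr (@is_boundary R K n X) z'.
Proof. by move=> [c cz]; apply/quot_prP; apply/asboolP; exists c; rewrite cz linearB. Qed.

Section NaturalHomotopy.
Variables (R : realType) (K : fieldType) (X Y : topologicalType).
Variable G : forall n, set (singular_simplex R n X).
Variable h : forall n, singular_simplex R n X ->
  continuousType (simplex R n * R)%type Y.
(** Restricted to [G] because a straight-line homotopy inside an open set exists only for simplices
    that are small compared with the grid. *)
Hypothesis h_face : forall n s i, @G n.+1 s -> forall t tau,
  h (s \o face R i : singular_simplex R n X) (t, tau) = h s (face_fun i t, tau).

Definition end_chain n (b : bool) : chains R K n X -> chains R K n Y :=
  fglift (fun s => chain1 K (cyl_end (h s) b)).

HB.instance Definition _ n b := GRing.Linear.on (@end_chain n b).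

Definition prism_chain n : chains R K n X -> chains R K n.+1 Y :=
  fglift (fun s => prism K (h s)).

HB.instance Definition _ n := GRing.Linear.on (@prism_chain n).

Lemma end_chain1 n b (s : singular_simplex R n X) :
  end_chain b (chain1 K s) = chain1 K (cyl_end (h s) b).
Proof. by rewrite /end_chain liftU scale1r. Qed.

Lemma prism_chain1 n (s : singular_simplex R n X) :
  prism_chain (chain1 K s) = prism K (h s).
Proof. by rewrite /prism_chain liftU scale1r. Qed.

Lemma boundary_end_chain n b (c : chains R K n.+1 X) :
  {in dom c, forall s, @G n.+1 s} ->
  boundary (end_chain b c) = end_chain b (boundary c).
Proof.
move=> cG; apply: (@freeg_ext_dom _ _ _ (@boundary R K n Y \o @end_chain n.+1 b)
  (@end_chain n b \o @boundary R K n X)) => s /cG sG /=.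
rewrite -/(chain1 K s) end_chain1 !boundary1 linear_sum; apply: eq_bigr => i _.
rewrite linearZ /= end_chain1; congr (_ *: chain1 K _).
apply/continuousEP => t. by rewrite [LHS]cyl_endE cyl_endE h_face.
Qed.

Lemma boundary_prism_chain0 (c : chains R K 0 X) :
  boundary (prism_chain c) = end_chain true c - end_chain false c.
Proof.
apply: (@freeg_ext_dom _ _ _ (@boundary R K 0 Y \o @prism_chain 0)
  (@end_chain 0 true \- @end_chain 0 false)) => s _ /=.
by rewrite -/(chain1 K s) prism_chain1 !end_chain1 boundary_prism0.
Qed.

(** The chain homotopy formula: compatibility with faces turns the prisms over faces in
    [boundary_prismS] into [prism_chain] of the boundary. *)
Lemma boundary_prism_chainS n (c : chains R K n.+1 X) :
  {in dom c, forall s, @G n.+1 s} ->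
  boundary (prism_chain c) =
  end_chain true c - end_chain false c - prism_chain (boundary c).
Proof.
move=> cG; apply: (@freeg_ext_dom _ _ _ (@boundary R K n.+1 Y \o @prism_chain n.+1)
  ((@end_chain n.+1 true \- @end_chain n.+1 false) \-
   (@prism_chain n \o @boundary R K n X))) => s /cG sG /=.
rewrite -/(chain1 K s) prism_chain1 !end_chain1 boundary_prismS; congr (_ - _).
rewrite boundary1 linear_sum; apply: eq_bigr => i _.
rewrite linearZ /= prism_chain1; congr (_ *: prism K _).
by apply/continuousEP => -[t tau] /=; rewrite h_face.
Qed.

Lemma end_chain_cycle n b (z : cycles R K n X) :
  {in dom (val z), forall s, @G n s} -> is_cycle (end_chain b (val z)).
Proof.
case: z => c; case: n c => // n c /= c0 cG.
by rewrite boundary_end_chain // (eqP c0) linear0.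
Qed.

Lemma end_chain_homologous n (z : cycles R K n X)
  (zG : {in dom (val z), forall s, @G n s}) :
  quot_pr (@is_boundary R K n Y) (Cycle (end_chain_cycle true zG)) =
  quot_pr (@is_boundary R K n Y) (Cycle (end_chain_cycle false zG)).
Proof.
apply: homology_eqP; exists (prism_chain (val z)) => /=.
case: z zG => c c0 zG; case: n c c0 zG => /= [|n] c c0 zG.
  exact: boundary_prism_chain0.
by rewrite boundary_prism_chainS // (eqP c0) linear0 subr0.
Qed.
End NaturalHomotopy.

Lemma within_continuous_comp_in (T U V : topologicalType) (A : set U)
  (f : U -> V) (g : T -> U) :
  {within A, continuous f} -> continuous g -> (forall x, A (g x)) ->
  continuous (f \o g).
Proof.
move=> /subspace_sigL_continuousP cf cg gA.
have cg' : continuous (fun x => exist (fun u => u \in A) (g x) (mem_set (gA x)) : A).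
  exact: continuous_set_type.
by move=> x; exact: (continuous_comp (cg' x) (cf _)).
Qed.

Section HomotopyInvariance.
Variables (R : realType) (K : fieldType).

Definition clamp (tau : R) : R := Num.min 1 (Num.max 0 tau).

Lemma clamp_continuous : continuous clamp.
Proof.
move=> x; apply: (@continuous_min R R (fun=> 1) (fun tau => Num.max 0 tau)).
  exact: cst_continuous.
by apply: (@continuous_max R R (fun=> 0) id) => //; exact: cst_continuous.
Qed.

Lemma clamp_itv tau : 0 <= clamp tau <= 1.
Proof. by rewrite /clamp ge_min lexx le_min ler01 le_max lexx. Qed.

Lemma clamp_id tau : 0 <= tau <= 1 -> clamp tau = tau.
Proof.
by move=> /andP[t0 t1]; rewrite /clamp (elimT max_idPr t0) (elimT min_idPr t1).
Qed.

(** Composing the homotopy with a simplex and [clamp] gives a cylinder that respects faces for every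
    simplex, so [G] can be everything. *)
Theorem homotopic_homology_map (X Y : topologicalType) (f g : continuousType X Y) n
  (a : homology R K n X) :
  homotopic R f g -> homology_map R K f n a = homology_map R K g n a.
Proof.
move=> [H [cH H0 H1]].
pose cyl m (s : singular_simplex R m X) (x : simplex R m * R) := H (s x.1, clamp x.2).
have ccyl m s : continuous (@cyl m s).
  apply: (within_continuous_comp_in (f := H) (g := fun x => (s x.1, clamp x.2)) cH).
    move=> x; apply: (@continuous_at_pair _ _ _ (fun x => s x.1) (fun x => clamp x.2)).
      apply: (@continuous_comp _ _ _ fst s); first exact: cvg_fst.
      exact: cts_fun.
    apply: (@continuous_comp _ _ _ snd clamp); first exact: cvg_snd.
    exact: clamp_continuous.
  by move=> x; split => //=; rewrite in_itv /= clamp_itv.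
pose h m s : continuousType (simplex R m * R)%type Y := mkcts (@ccyl m s).
have hE m (s : singular_simplex R m X) t tau : h m s (t, tau) = H (s t, clamp tau) by [].
have [z <-] := quot_pr_surj a.
have zT : {in dom (val z), forall s, [set: singular_simplex R n X] s} by [].
have hf m (s : singular_simplex R m.+1 X) i : setT s -> forall t tau,
  h m (s \o face R i) (t, tau) = h m.+1 s (face_fun i t, tau) by [].
have fE (b : bool) k : (forall x, H (x, b%:R) = (k : continuousType X Y) x) ->
    end_chain h b (val z) = chain_map k (val z).
  move=> Hk; apply: (@freeg_ext_dom _ _ _ (@end_chain R K X Y h n b) (@chain_map R K X Y k n)) => s _.
  rewrite /= -/(chain1 K s) chain_map1 end_chain1; congr chain1; apply/continuousEP => t.
  by rewrite cyl_endE hE clamp_id ?Hk //; case: b {Hk}; rewrite ?lexx ?ler01.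
rewrite /homology_map /= !quotmod_mapE.
have := end_chain_homologous (G := fun _ => setT) hf zT.
by move=> /esym; congr (_ = _); congr quot_pr; apply: val_inj => /=; exact: fE.
Qed.
End HomotopyInvariance.

(** * Interpolation on a grid *)

Section Grid.
Variables (R : realType) (N m k : nat).
Local Notation K := k.+1.
(** Numerators over the common denominator [K = k.+1], from 0 to [K] inclusive; the grid is a finite
    type. *)
Local Notation grid := {ffun 'I_m.+1 -> 'I_k.+2}.

Definition on_simplex (v : grid) := (\sum_i v i == K)%N.

Definition grid_row (v : grid) : 'rV[R]_m.+1 := \row_i ((v i)%:R / K%:R).

Lemma grid_row_simplex v : on_simplex v -> simplex R m (grid_row v).
Proof.
move=> /eqP vK; split=> [i|]; first by rewrite mxE divr_ge0.
under eq_bigr do rewrite mxE.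
by rewrite -mulr_suml -natr_sum vK divff // pnatr_eq0.
Qed.

(** A product of tent functions. Over the grid points of the simplex these do not sum to 1, hence
    the division by [hat_sum] in [interp]. *)
Definition hat (v : grid) (t : 'rV[R]_m.+1) : R :=
  \prod_i Num.max 0 (1 - `|K%:R * t ord0 i - (v i)%:R|).

Lemma hat_ge0 v t : 0 <= hat v t.
Proof. by apply: prodr_ge0 => i _; rewrite le_max lexx. Qed.

Lemma hat_gt0 v t :
  (0 < hat v t) = [forall i, `|K%:R * t ord0 i - (v i)%:R| < 1].
Proof.
rewrite lt0r hat_ge0 andbT; apply/prodf_neq0/forallP => h i.
  have := h i isT; rewrite ltNge; apply: contra => h1.
  by apply/eqP/max_idPl; rewrite subr_le0.
by move=> _; rewrite gt_eqF // lt_max subr_gt0 h orbT.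
Qed.

Lemma hat_neq0_near v t i :
  hat v t != 0 -> `|grid_row v ord0 i - t ord0 i| < K%:R^-1.
Proof.
move=> h; have : 0 < hat v t by rewrite lt0r h hat_ge0.
rewrite hat_gt0 => /forallP/(_ i); rewrite mxE => h1.
have K0 : 0 < K%:R :> R by rewrite ltr0n.
rewrite (_ : _ - _ = ((v i)%:R - K%:R * t ord0 i) / K%:R); last first.
  by rewrite mulrBl mulrAC divff ?mul1r // gt_eqF.
by rewrite normrM distrC gtr0_norm ?invr_gt0 // -[ltRHS]mul1r ltr_pM2r ?invr_gt0.
Qed.

(* Rounding the partial sums down keeps the total and moves each coordinate by
   less than one step. *)
Lemma hat_cover t : simplex R m t -> exists2 v, on_simplex v & 0 < hat v t.
Proof.
move=> [t0 t1].
pose T j := K%:R * \sum_(l < m.+1 | (l < j)%N) t ord0 l.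
have T_ge0 j : 0 <= T j by rewrite mulr_ge0 // sumr_ge0.
have TS (i : 'I_m.+1) : T i.+1 = T i + K%:R * t ord0 i.
  rewrite /T -mulrDr; congr (_ * _); rewrite (bigD1 i) //= addrC; congr (_ + _).
  by apply: eq_bigl => l; rewrite -val_eqE /=; lia.
have TSle j : T j <= T j.+1.
  have [jm|jm] := ltnP j m.+1.
    by have := TS (Ordinal jm) => /= ->; rewrite lerDl mulr_ge0.
  apply: ler_wpM2l => //; rewrite le_eqVlt; apply/orP; left; apply/eqP.
  by apply: eq_bigl => l; move: (ltn_ord l); lia.
have T0 : T 0%N = 0 by rewrite /T big1 ?mulr0.
have TK : T m.+1 = K%:R.
  by rewrite /T -[RHS]mulr1 -t1; congr (_ * _); apply: eq_bigl => l; rewrite ltn_ord.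
pose c j := Num.truncn (T j).
have cS : {homo c : x y / (x <= y)%N}.
  by apply: homo_leq => // [|j]; [exact: leq_trans|apply: le_truncn; exact: TSle].
have c0 : c 0%N = 0%N by rewrite /c T0 truncn0.
have cK : c m.+1 = K by rewrite /c TK natrK.
have clt (i : 'I_m.+1) : (c i.+1 - c i < k.+2)%N.
  by have := cS i.+1 m.+1 (ltn_ord i); rewrite cK; lia.
exists [ffun i => Ordinal (clt i)].
  rewrite /on_simplex; under eq_bigr do rewrite ffunE /=.
  by rewrite -(big_mkord xpredT (fun i => c i.+1 - c i)%N) telescope_sumn // c0 cK.
rewrite hat_gt0; apply/forallP => i; rewrite ffunE /=.
rewrite natrB; last exact: cS.
have /andP[a1 a2] := truncn_itv (T_ge0 i).
have /andP[b1 b2] := truncn_itv (T_ge0 i.+1).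
move: b1 b2; rewrite -/(c i) in a1 a2 *; rewrite -/(c i.+1) TS => b1 b2.
move: a1 a2 b1 b2; rewrite -!natr1 ltr_norml => a1 a2 b1 b2.
by apply/andP; split; lra.
Qed.

Definition hat_sum t := \sum_(v | on_simplex v) hat v t.

Lemma hat_sum_gt0 t : simplex R m t -> 0 < hat_sum t.
Proof.
move=> /hat_cover[v vK v0]; rewrite /hat_sum (bigD1 v) //= ltr_pwDl //.
by rewrite sumr_ge0 // => w _; exact: hat_ge0.
Qed.

Definition interp (c : grid -> 'rV[R]_N) (t : 'rV[R]_m.+1) : 'rV[R]_N :=
  (hat_sum t)^-1 *: \sum_(v | on_simplex v) hat v t *: c v.

(** [interp c t] is a convex combination of the values at grid points of nonzero weight, and balls
    are convex; [hat_cover] supplies a positive weight for strictness. *)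
Lemma interp_near (c : grid -> 'rV[R]_N) t y (e : R) : simplex R m t ->
  (forall v, on_simplex v -> hat v t != 0 -> `|c v - y| < e) ->
  `|interp c t - y| < e.
Proof.
move=> tS ce; have h0 := hat_sum_gt0 tS.
have -> : interp c t - y =
    (hat_sum t)^-1 *: \sum_(v | on_simplex v) hat v t *: (c v - y).
  under eq_bigr do rewrite scalerBr.
  by rewrite sumrB -scaler_suml -/(hat_sum t) scalerBr scalerA mulVf ?gt_eqF // scale1r.
rewrite normrZ ger0_norm ?invr_ge0 ?ltW // mulrC ltr_pdivrMr //.
apply: le_lt_trans (ler_norm_sum _ _ _) _.
have [v vK v0] := hat_cover tS.
rewrite /hat_sum mulr_sumr (bigD1 v) //= [ltRHS](bigD1 v) //=; apply: ltr_leD.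
  rewrite normrZ ger0_norm ?hat_ge0 // mulrC ltr_pM2r //.
  by apply: ce => //; rewrite gt_eqF.
apply: ler_sum => w /andP[wK _]; rewrite normrZ ger0_norm ?hat_ge0 //.
have [->|w0] := eqVneq (hat w t) 0; first by rewrite mul0r mulr0.
by rewrite mulrC ler_wpM2r ?hat_ge0 // ltW // ce.
Qed.

Lemma hat_continuous v : continuous (fun t : simplex R m => hat v (val t)).
Proof.
apply: continuous_big => [|i _ t]; first exact: mul_continuous.
pose f (t : simplex R m) : R := K%:R * val t ord0 i - (v i)%:R.
have cf : continuous f.
  move=> u; apply: (@continuousB R R _ (fun t : simplex R m =>
    K%:R * val t ord0 i) (fun=> (v i)%:R)); last exact: cst_continuous.
  apply: (@continuousM R _ (fun=> K%:R) (fun t : simplex R m => val t ord0 i)).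
    exact: cst_continuous.
  exact: coord_val_continuous.
apply: (@continuous_max R _ (fun=> 0) (fun t => 1 - `|f t|)).
  exact: cst_continuous.
apply: (@continuousB R R _ (fun=> 1) (fun t => `|f t|)); first exact: cst_continuous.
apply: (@continuous_comp _ _ _ f (fun x : R => `|x|)); first exact: cf.
exact: norm_continuous.
Qed.

Lemma interp_continuous c : continuous (fun t : simplex R m => interp c (val t)).
Proof.
have cs : continuous (fun t : simplex R m => hat_sum (val t)).
  by apply: continuous_sum => v _; exact: hat_continuous.
have cn : continuous (fun t : simplex R m =>
    \sum_(v | on_simplex v) hat v (val t) *: c v).
  apply: continuous_big => [|v _ t]; first exact: add_continuous.
  apply: (@continuousZ _ _ _ (fun t : simplex R m => hat v (val t)) (fun=> c v)).
    exact: hat_continuous.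
  exact: cst_continuous.
move=> t; apply: (@continuousZ _ _ _ (fun t : simplex R m => (hat_sum (val t))^-1) _ t _ (cn t)).
apply: continuousV; last exact: cs.
by rewrite gt_eqF // hat_sum_gt0 //; exact/set_mem/(valP t).
Qed.
End Grid.

(** * Compatibility of interpolation with faces *)

Section GridFace.
Variables (R : realType) (m k : nat) (i : 'I_m.+2).
Local Notation K := k.+1.

Definition grid_face (v : {ffun 'I_m.+1 -> 'I_k.+2}) : {ffun 'I_m.+2 -> 'I_k.+2} :=
  [ffun j => oapp v ord0 (unlift i j)].

Lemma grid_row_face v : grid_row R (grid_face v) = face_row i (grid_row R v).
Proof.
apply/rowP => j; rewrite !mxE ffunE; case: (unlift i j) => [l|] /=.
  by rewrite mxE.
by rewrite mul0r.
Qed.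

Lemma on_simplex_face v : on_simplex (grid_face v) = on_simplex v.
Proof.
rewrite /on_simplex (bigD1_ord i) //= ffunE unlift_none add0n.
by congr (_ == _); apply: eq_bigr => j _; rewrite ffunE liftK.
Qed.

Lemma hat_face v (t : 'rV[R]_m.+1) : hat (grid_face v) (face_row i t) = hat v t.
Proof.
rewrite /hat (bigD1_ord i) //= ffunE unlift_none face_row0 mulr0 subrr normr0 subr0.
rewrite (max_idPr ler01) mul1r.
by apply: eq_bigr => j _; rewrite ffunE liftK face_rowE.
Qed.

Lemma hat_off_face (v : {ffun 'I_m.+2 -> 'I_k.+2}) (t : 'rV[R]_m.+1) :
  v i != ord0 -> hat v (face_row i t) = 0.
Proof.
move=> vi; apply/eqP/prodf_eq0; exists i => //.
rewrite face_row0 mulr0 add0r normrN ger0_norm //; apply/eqP/max_idPl.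
by rewrite subr_le0 ler1n lt0n.
Qed.

Lemma sum_hat_face (V : lmodType R) (F : {ffun 'I_m.+2 -> 'I_k.+2} -> V)
    (t : 'rV[R]_m.+1) :
  \sum_(v | on_simplex v) hat v (face_row i t) *: F v =
  \sum_(v | on_simplex v) hat v t *: F (grid_face v).
Proof.
rewrite (bigID (fun v : {ffun _} => v i == ord0)) /= addrC big1 ?add0r; last first.
  by move=> v /andP[_ vi]; rewrite hat_off_face // scale0r.
rewrite (reindex_onto grid_face (fun v => [ffun j => v (fintype.lift i j)])) /=.
  apply: eq_big => [v|v _]; last by rewrite hat_face.
  rewrite on_simplex_face ffunE unlift_none eqxx andbT.
  case: on_simplex => //=; apply/eqP/ffunP => j.
  by rewrite !ffunE liftK.
move=> v /andP[_ /eqP vi]; apply/ffunP => j; rewrite ffunE.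
by case: unliftP => [l|] -> /=; rewrite ?ffunE ?vi.
Qed.

(** On a face the weights of grid points off that face vanish, and the remaining weights are those
    of the grid one dimension lower. *)
Lemma interp_face N (c : {ffun 'I_m.+2 -> 'I_k.+2} -> 'rV[R]_N) (t : 'rV[R]_m.+1) :
  interp c (face_row i t) = interp (c \o grid_face) t.
Proof.
rewrite /interp sum_hat_face; congr (_^-1 *: _).
(* The case of the constant 1 compares the denominators. *)
have := sum_hat_face (fun=> 1 : R^o) t; rewrite /hat_sum.
by under eq_bigr do rewrite [_ *: _]mulr1; move=> ->; apply: eq_bigr => v _; rewrite [_ *: _]mulr1.
Qed.
End GridFace.

(** * Homology of open subsets of Euclidean space *)

Section Rows.
Variable R : realType.

Lemma row_norm_lt n (x : 'rV[R]_n) (e : R) : 0 < e ->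
  (forall j, `|x ord0 j| < e) -> `|x| < e.
Proof.
move=> e0 xe; rewrite [`|x|]mx_normrE; apply/bigmax_ltP; split => //.
by move=> [i j] _ /=; rewrite (ord1 i).
Qed.

Lemma row_norm_ge n (x : 'rV[R]_n) j : `|x ord0 j| <= `|x|.
Proof.
by rewrite [leRHS]mx_normrE; apply: (le_bigmax _ (fun ij => `|x ij.1 ij.2|) (ord0, j)).
Qed.

Lemma nbhs_set_type (X : topologicalType) (A : set X) (x : A) (B : set A) :
  nbhs x B -> exists2 C, nbhs (val x) C & forall y : A, C (val y) -> B y.
Proof.
move=> [D [[C oC <-] Cx CB]]; exists C; first exact: open_nbhs_nbhs.
by move=> y Cy; exact: CB.
Qed.

Lemma compact_set_type (X : topologicalType) (A : set X) :
  compact A -> compact [set: A].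
Proof.
move=> /compact_near_coveringP cA; apply/compact_near_coveringP => I F Q FF Qn.
have : \near F, A `<=` (fun x => forall y : A, val y = x -> Q F y).
  apply: cA => x Ax; have [[B1 B2] /= [nB1 nB2] BQ] := Qn (exist _ x (mem_set Ax)) Logic.I.
  have [C nC CB] := nbhs_set_type nB1.
  exists (C, B2) => //= -[x' i] /= [Cx' B2i] y yx'.
  by apply: (BQ (y, i)); split => //=; apply: CB; move: Cx'; rewrite -yx'.
by apply: filterS => i Qi y _; apply: (Qi (val y)) => //; exact/set_mem/(valP y).
Qed.

Lemma simplex_compact n : compact (simplex R n).
Proof.
apply: bounded_closed_compact.
  exists 1; split => // M M1 t [t0 t1] /=.
  apply/ltW/row_norm_lt; first exact: lt_trans ltr01 M1.
  move=> j; rewrite ger0_norm //; apply: le_lt_trans M1.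
  by rewrite -t1 (bigD1 j) //= lerDl sumr_ge0.
have -> : simplex R n = \bigcap_i (fun t => t ord0 i) @^-1` [set x | 0 <= x] `&`
    (fun t => \sum_i t ord0 i) @^-1` [set 1].
  by apply/seteqP; split=> [t [t0 t1]|t [t0 t1]]; split => // i; [move=> _|]; exact: t0.
apply: closedI.
  apply: closed_bigI => i _; apply: preimage_closed; last exact: closed_ge.
  by move=> x _; exact: coord_row_continuous.
apply: preimage_closed; last exact: closed_eq.
by move=> x _; apply: continuous_sum => i _; exact: coord_row_continuous.
Qed.

Lemma norm_convex_lt (V : normedModType R) (x y z : V) (tau e : R) :
  0 <= tau <= 1 -> `|x - z| < e -> `|y - z| < e ->
  `|(1 - tau) *: x + tau *: y - z| < e.
Proof.
move=> /andP[t0 t1] xe ye.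
have -> : (1 - tau) *: x + tau *: y - z = (1 - tau) *: (x - z) + tau *: (y - z).
  rewrite !scalerBr addrACA -opprD -scalerDl; congr (_ - _).
  by rewrite subrK scale1r.
apply: le_lt_trans (ler_normD _ _) _; rewrite !normrZ !ger0_norm ?subr_ge0 //.
have [->|t1'] := eqVneq tau 1; first by rewrite subrr mul0r add0r mul1r.
have : tau < 1 by rewrite lt_neqAle t1'.
by nra.
Qed.
End Rows.

Section CountableHomology.
Variables (R : realType) (K : fieldType) (N : nat) (P : set 'rV[R]_N).
Hypothesis P_open : open P.
Local Notation simp m := (singular_simplex R m P).

(** The value 0 off the simplex lets a table have an entry at every grid point. *)
Definition simplex_ext m (s : simp m) (x : 'rV[R]_m.+1) : 'rV[R]_N :=
  oapp (fun t : simplex R m => val (s t)) 0 (insub x).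

Lemma simplex_ext_val m (s : simp m) (t : simplex R m) :
  simplex_ext s (val t) = val (s t).
Proof. by rewrite /simplex_ext valK. Qed.

Lemma simplex_ext_face m (s : simp m.+1) i x : simplex R m x ->
  simplex_ext s (face_row i x) = simplex_ext (s \o face R i : simp m) x.
Proof.
move=> xS; pose t : simplex R m := exist _ x (mem_set xS).
rewrite -[x]/(val t) (simplex_ext_val (s \o face R i : simp m)).
by rewrite -[face_row i _]/(val (face_fun i t)) simplex_ext_val.
Qed.

(** Integer entries at scale [k.+1] make the type of tables countable. *)
Definition round k (y : 'rV[R]_N) : 'rV[int]_N :=
  \row_j Num.floor (k.+1%:R * y ord0 j).

Definition unround k (z : 'rV[int]_N) : 'rV[R]_N :=
  \row_j ((z ord0 j)%:~R / k.+1%:R).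

Lemma round_near k y (e : R) : k.+1%:R^-1 < e -> `|unround k (round k y) - y| < e.
Proof.
have K0 : 0 < k.+1%:R :> R by rewrite ltr0n.
move=> ke; apply: row_norm_lt => [|j]; first by apply: lt_trans ke; rewrite invr_gt0.
apply: le_lt_trans ke; rewrite !mxE.
set x := y ord0 j; have /andP[f1 f2] := floor_itv (k.+1%:R * x).
rewrite (_ : _ - x = ((Num.floor (k.+1%:R * x))%:~R - k.+1%:R * x) / k.+1%:R).
  rewrite normrM [X in _ * X]gtr0_norm ?invr_gt0 // ler_piMl ?invr_ge0 //.
  by rewrite ler_norml; move: f2; rewrite intrD => f2; apply/andP; split; lra.
by rewrite mulrBl mulrAC divff ?mul1r // gt_eqF.
Qed.

Definition table k m := {ffun {ffun 'I_m.+1 -> 'I_k.+2} -> 'rV[int]_N}.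

Definition table_interp k m (z : table k m) (t : 'rV[R]_m.+1) : 'rV[R]_N :=
  interp (fun v => unround k (z v)) t.

Definition simplex_table k m (s : simp m) : table k m :=
  [ffun v => round k (simplex_ext s (grid_row R v))].

Definition approx k m (s : simp m) (t : 'rV[R]_m.+1) : 'rV[R]_N :=
  table_interp (simplex_table k s) t.

Lemma approx_face k m (s : simp m.+1) i (t : 'rV[R]_m.+1) :
  approx k s (face_row i t) = approx k (s \o face R i : simp m) t.
Proof.
rewrite /approx /table_interp interp_face /interp; congr (_ *: _).
apply: eq_bigr => v vS; rewrite /= !ffunE grid_row_face simplex_ext_face //.
exact: grid_row_simplex.
Qed.

Lemma approx_continuous k m (s : simp m) :
  continuous (fun t : simplex R m => approx k s (val t)).
Proof. exact: interp_continuous. Qed.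

Definition line k m (s : simp m) (x : simplex R m * R) : 'rV[R]_N :=
  (1 - clamp x.2) *: val (s x.1) + clamp x.2 *: approx k s (val x.1).

Definition good k m : set (simp m) := [set s | forall x, P (line k s x)].

Lemma line_continuous k m (s : simp m) : continuous (line k s).
Proof.
have c2 : continuous (fun x : simplex R m * R => clamp x.2).
  move=> x; apply: (@continuous_comp _ _ _ snd (@clamp R)); first exact: cvg_snd.
  exact: clamp_continuous.
have c1 : continuous (fun x : simplex R m * R => 1 - clamp x.2).
  move=> x; apply: (@continuousB R R _ (fun=> 1) (fun x : simplex R m * R => clamp x.2)).
    exact: cst_continuous.
  exact: c2.
have cs : continuous (fun x : simplex R m * R => val (s x.1)).
  move=> x; apply: (@continuous_comp _ _ _ fst (fun t : simplex R m => val (s t))); first exact: cvg_fst.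
  apply: (@continuous_comp _ _ _ s val); first exact: cts_fun.
  exact: set_val_continuous.
have ca : continuous (fun x : simplex R m * R => approx k s (val x.1)).
  move=> x; apply: (@continuous_comp _ _ _ fst (fun t : simplex R m => approx k s (val t))).
    exact: cvg_fst.
  exact: approx_continuous.
move=> x; apply: (@continuousD R _ _ (fun x : simplex R m * R => (1 - clamp x.2) *: val (s x.1))
  (fun x : simplex R m * R => clamp x.2 *: approx k s (val x.1))).
  exact: (continuousZ (c1 x) (cs x)).
exact: (continuousZ (c2 x) (ca x)).
Qed.

(** Near [t0] all table entries of nonzero weight are close to [s t0], hence so is the whole
    segment, and it stays in a ball inside [P]. Compactness of the simplex makes [k] uniform. *)
Lemma good_near m (s : simp m) : \forall k \near \oo, good k s.
Proof.
have /compact_near_coveringP/(_ nat \oo (fun k t => forall tau, P (line k s (t, tau)))) :=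
  compact_set_type (@simplex_compact R m).
move=> cov; suff : \forall k \near \oo, [set: simplex R m] `<=`
    (fun t => forall tau, P (line k s (t, tau))).
  by apply: filterS => k sk [t tau]; exact: sk.
apply: cov => t0 _; set y := val (s t0).
have /nbhs_ballP[e /= e0 eP] : nbhs y P.
  by apply: open_nbhs_nbhs; split => //; exact/set_mem/(valP (s t0)).
(* Half of [e] pays for the variation of [s] near [t0], half for rounding. Likewise [dl] below is
   shared between the distance from [t] to [t0] and that from [t] to the grid. *)
have e2 : 0 < e / 2 by rewrite divr_gt0.
have cs : {for t0, continuous (fun t => val (s t))}.
  apply: (@continuous_comp _ _ _ s val); first exact: cts_fun.
  exact: set_val_continuous.
have [C nC CB] := nbhs_set_type (cs _ (nbhsx_ballx y _ e2)).
have [dl /= d0 dC] := (nbhs_ballP _ _).1 nC.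
have d2 : 0 < dl / 2 by rewrite divr_gt0.
pose B (t : simplex R m) := `|val t - val t0| < dl / 2.
have nB : nbhs t0 B.
  apply: (@filterS _ (nbhs t0) _ (val @^-1` ball (val t0) (dl / 2))).
    by move=> t; rewrite /= mx_norm_ball /ball_ /= /B distrC.
  exact: (@set_val_continuous _ _ t0 _ (nbhsx_ballx (val t0) _ d2)).
have sB (t : simplex R m) : `|val t - val t0| < dl -> `|val (s t) - y| < e / 2.
  move=> tt0; have : C (val t) by apply: dC; rewrite mx_norm_ball /ball_ /= distrC.
  by move/CB; rewrite mx_norm_ball /ball_ /= distrC.
have nk : \forall k \near \oo, (k.+1%:R^-1 : R) < Num.min (dl / 2) (e / 2).
  have pe : 0 < Num.min (dl / 2) (e / 2) by rewrite lt_min d2 e2.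
  exact: (near_infty_natSinv_lt (PosNum pe)).
exists ([set t | B t], [set k | (k.+1%:R^-1 : R) < Num.min (dl / 2) (e / 2)]) => //.
move=> [t k] /= [Bt]; rewrite lt_min => /andP[kd ke] tau.
apply: eP; rewrite mx_norm_ball /ball_ /= distrC; apply: norm_convex_lt.
- exact: clamp_itv.
- apply: (@lt_trans _ _ (e / 2)); last by rewrite ltr_pdivrMr // mulr_natr mulr2n ltrDl.
  by apply: sB; apply: lt_trans Bt _; rewrite ltr_pdivrMr // mulr_natr mulr2n ltrDl.
apply: interp_near; first exact/set_mem/(valP t).
move=> v vS vt; rewrite ffunE.
pose u : simplex R m := exist _ (grid_row R v) (mem_set (grid_row_simplex R vS)).
rewrite -[grid_row R v]/(val u) simplex_ext_val.
rewrite -(subrK (val (s u)) (unround _ _)) -addrA [e]splitr.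
apply: le_lt_trans (ler_normD _ _) _; apply: ltrD; first exact: round_near.
apply: sB; rewrite -(subrK (val t) (val u)) -addrA [dl]splitr.
apply: le_lt_trans (ler_normD _ _) _; apply: ltrD => //.
apply: lt_trans kd; apply: row_norm_lt => [|j]; first by rewrite invr_gt0.
by have := hat_neq0_near j vt; rewrite !mxE.
Qed.

(** The constant homotopy outside [good k] keeps the family defined on all simplices. *)
Definition line_simplex k m (s : simp m) (x : simplex R m * R) : P :=
  if pselect (good k s) is left sk then exist _ (line k s x) (mem_set (sk x))
  else s x.1.

Lemma line_simplexE k m (s : simp m) x :
  good k s -> val (line_simplex k s x) = line k s x.
Proof. by move=> sk; rewrite /line_simplex; case: pselect. Qed.

Lemma line_simplex_continuous k m (s : simp m) : continuous (line_simplex k s).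
Proof.
rewrite /line_simplex; case: pselect => sk.
  by apply: continuous_set_type; exact: line_continuous.
move=> x; apply: (@continuous_comp _ _ _ fst s); first exact: cvg_fst.
exact: cts_fun.
Qed.

Definition line_homotopy k m (s : simp m) :
    continuousType (simplex R m * R)%type P :=
  mkcts (@line_simplex_continuous k m s).

Lemma line_homotopy_face k m (s : simp m.+1) i : good k s -> forall t tau,
  line_homotopy k (s \o face R i : simp m) (t, tau) =
  line_homotopy k s (face_fun i t, tau).
Proof.
have lf t tau : line k (s \o face R i : simp m) (t, tau) =
    line k s (face_fun i t, tau).
  by rewrite /line /= approx_face.
move=> sk t tau.
have fk : good k (s \o face R i : simp m) by move=> -[u ta]; rewrite lf; exact: sk.
apply: val_inj; rewrite -[LHS]/(val (line_simplex _ _ _)) line_simplexE // lf.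
by rewrite -[RHS]/(val (line_simplex _ _ _)) line_simplexE.
Qed.

Lemma line_homotopy_end m k (s : simp m) : cyl_end (line_homotopy k s) false = s.
Proof.
apply/continuousEP => t; rewrite cyl_endE -[LHS]/(line_simplex k s (t, 0)).
have [sk|nsk] := pselect (good k s).
  apply: val_inj; rewrite line_simplexE // /line /= clamp_id ?lexx ?ler01 //.
  by rewrite subr0 scale1r scale0r addr0.
by rewrite /line_simplex; case: pselect.
Qed.

Definition coded_simplices m : set (simp m) := [set s |
  exists k (z : table k m), forall t, val (s t) = table_interp z (val t)].

Lemma line_homotopy_coded m k (s : simp m) :
  good k s -> coded_simplices (cyl_end (line_homotopy k s) true).
Proof.
move=> sk; exists k, (simplex_table k s) => t.
rewrite cyl_endE -[X in val X]/(line_simplex k s (t, 1)) line_simplexE //.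
by rewrite /line /= clamp_id ?lexx ?ler01 // subrr scale0r add0r scale1r.
Qed.

(** A table determines its simplex, so it suffices to choose one for each code that has one. *)
Lemma coded_simplices_countable m :
  exists e : nat -> option (simp m), forall s, coded_simplices s ->
    exists j, e j = Some s.
Proof.
pose code := {k : nat & table k m}.
pose dec (c : code) (s : simp m) := forall t, val (s t) = table_interp (projT2 c) (val t).
have /choice[g gP] : forall j : nat, exists o : option (simp m),
    forall c s, unpickle j = Some (c : code) -> dec c s -> o = Some s.
  move=> j; case: (unpickle j) => [c|]; last by exists None.
  have [[s cs]|ns] := pselect (exists s, dec c s); last first.
    by exists None => c' s [<-] cs; case: ns; exists s.
  exists (Some s) => c' s' [<-] cs'; congr Some; apply/continuousEP => t.
  by apply: val_inj; rewrite cs cs'.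
exists g => s [k [z sz]]; exists (pickle (existT _ k z : code)).
by apply: (gP _ (existT _ k z : code)) => //; rewrite pickleK.
Qed.

(** A cycle involves finitely many simplices, so one [k] is good for all of them, and the line
    homotopy carries the cycle to a homologous one made of coded simplices. *)
Theorem homology_countably_spanned n :
  exists e : nat -> homology R K n P, forall a, lspan (range e) a.
Proof.
have [g gP] := coded_simplices_countable n.
pose e j : chains R K n P := if g j is Some s then chain1 K s else 0.
(* Single coded simplices need not be cycles; countably many cycles that span all cycles among their
   combinations are selected instead. *)
pose S : set (chains R K n P) := [set c | is_cycle c /\ lspan (range e) c].
have [f fS fspan] := countable_lspan_subset (S := S) (fun c cS => cS.2).
have fcyc j : is_cycle (f j).
  by case: (fS j) => [->|[]//]; exact: (rpred0 (@is_cycle R K n P)).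
pose cl c (cc : is_cycle c) := quot_pr (@is_boundary R K n P) (Cycle cc).
exists (fun j => cl (f j) (fcyc j)) => a.
have cl_span c (cc : is_cycle c) : lspan (range f) c ->
    lspan (range (fun j => cl (f j) (fcyc j))) (cl c cc).
  move=> cf; elim: cf cc => [|x _ v [j _ <-] vf IH] cc.
    rewrite (_ : cl 0 cc = 0); first exact: lspan0.
    rewrite -(linear0 (@quot_pr _ _ (@is_boundary R K n P))); congr quot_pr.
    exact: val_inj.
  have vc : is_cycle v.
    have fj : f j \in @is_cycle R K n P := fcyc j.
    have cc' : x *: f j + v \in @is_cycle R K n P := cc.
    have -> : v = (x *: f j + v) - x *: f j by rewrite addrAC subrr add0r.
    exact: rpredB cc' (rpredZ _ fj).
  rewrite (_ : cl _ cc = x *: cl _ (fcyc j) + cl v vc).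
    by apply: lspan_cons; [exists j|exact: IH].
  by rewrite /cl -linearP; congr quot_pr; exact: val_inj.
have [z <-] := quot_pr_surj a.
have [k zk] : exists k, {in dom (val z), forall s : simp n, good k s}.
  have : \forall k \near \oo, {in dom (val z), forall s : simp n, good k s}.
    elim: (dom _) => [|s l IH]; first by near=> k.
    apply: filterS2 (good_near s) IH => k sk lk s'.
    by rewrite inE => /orP[/eqP->//|/lk].
  by move/filter_ex.
have hf m (s : simp m.+1) i : @good k m.+1 s -> forall t tau,
    line_homotopy k (s \o face R i : simp m) (t, tau) =
    line_homotopy k s (face_fun i t, tau) by exact: line_homotopy_face.
have := end_chain_homologous (G := @good k) hf zk.
rewrite (_ : Cycle (end_chain_cycle hf false zk) = z); last first.
  apply: val_inj => /=.
  apply: (@freeg_ext_dom _ _ _ (@end_chain R K _ _ (@line_homotopy k) n false) idfun).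
  by move=> s _; rewrite /= -/(chain1 K s) end_chain1 line_homotopy_end.
move=> <-; apply: cl_span; apply: fspan; split; first exact: (end_chain_cycle hf true zk).
rewrite -[val z]freeg_sumE linear_sum big_seq; apply: lspan_sum => s /zk sk.
suff -> : Freeg [:: (coeff s (val z), s)] = coeff s (val z) *: chain1 K s.
  rewrite linearZ /= end_chain1; apply: lspanZ; apply: sub_lspan.
  have [j gj] := gP _ (line_homotopy_coded sk).
  by exists j => //; rewrite /e gj.
by apply/eqP/freeg_eqP => y; rewrite coeffZ !coeffU mul1r.
Unshelve. all: by end_near. Qed.
End CountableHomology.

(** * Euclidean neighbourhood retracts *)

Section PointwiseContinuity.
Variables (R : realType) (T : topologicalType) (V : normedModType R).
Implicit Types (f g : T -> V) (s t : T -> R) (x : T).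

Lemma cts_add f g x : {for x, continuous f} -> {for x, continuous g} ->
  {for x, continuous (fun y => f y + g y)}.
Proof. exact: continuousD. Qed.

Lemma cts_sub f g x : {for x, continuous f} -> {for x, continuous g} ->
  {for x, continuous (fun y => f y - g y)}.
Proof. exact: continuousB. Qed.

Lemma cts_cst (Z : topologicalType) (a : Z) x : {for x, continuous (fun _ : T => a)}.
Proof. exact: cst_continuous. Qed.

Lemma cts_comp (Y Z : topologicalType) (f : T -> Y) (g : Y -> Z) x :
  {for x, continuous f} -> {for f x, continuous g} ->
  {for x, continuous (fun y => g (f y))}.
Proof. exact: continuous_comp. Qed.

Lemma cts_norm f x : {for x, continuous f} -> {for x, continuous (fun y => `|f y|)}.
Proof. by move=> cf; apply: cts_comp cf _; exact: norm_continuous. Qed.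

Lemma cts_mul s t x : {for x, continuous s} -> {for x, continuous t} ->
  {for x, continuous (fun y => s y * t y)}.
Proof. exact: continuousM. Qed.

Lemma cts_near_eq (Z : topologicalType) (f g : T -> Z) x :
  (\forall y \near x, f y = g y) -> {for x, continuous f} -> {for x, continuous g}.
Proof.
move=> fg cf B; rewrite -(nbhs_singleton fg) => /cf.
rewrite !nbhs_simpl /=; apply: filterS2 fg => y /= -> //.
Qed.

(* At [x] the two pieces agree, so it does not matter which one applies nearby. *)
Lemma cts_pieces (Z : topologicalType) (f g h : T -> Z) x :
  h x = f x -> h x = g x -> (forall y, h y = f y \/ h y = g y) ->
  {for x, continuous f} -> {for x, continuous g} -> {for x, continuous h}.
Proof.
move=> hf hg hfg cf cg B hB.
have fB : nbhs x (f @^-1` B) by apply: cf; rewrite -hf.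
have gB : nbhs x (g @^-1` B) by apply: cg; rewrite -hg.
rewrite nbhs_simpl /=; apply: filterS2 fB gB => y /= fy gy.
by case: (hfg y) => ->.
Qed.

Lemma cts_lt s x c : {for x, continuous s} -> s x < c ->
  \forall y \near x, s y < c.
Proof. by move=> cs sc; apply: (cvgr_lt (s x)). Qed.

Lemma cts_gt s x c : {for x, continuous s} -> c < s x ->
  \forall y \near x, c < s y.
Proof. by move=> cs sc; apply: (cvgr_gt (s x)). Qed.

Lemma within_cts_near (Z : topologicalType) (A : set T) (f : T -> Z) x B :
  {within A, continuous f} -> A x -> nbhs (f x) B ->
  \forall y \near x, A y -> B (f y).
Proof. by move=> /subspace_continuousP/(_ x) cf /cf/(_ B). Qed.
End PointwiseContinuity.

(** * The Euclidean norm and radial projection *)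

Section EuclideanNorm.
Variables (R : realType) (n : nat).
Implicit Types u v : 'rV[R]_n.

Definition enorm u : R := Num.sqrt (sqnorm u).

Lemma sqnorm_ge0 u : 0 <= sqnorm u.
Proof. by apply: sumr_ge0 => i _; exact: sqr_ge0. Qed.

Lemma enorm_ge0 u : 0 <= enorm u. Proof. exact: sqrtr_ge0. Qed.

Lemma sqr_enorm u : enorm u ^+ 2 = sqnorm u.
Proof. by rewrite sqr_sqrtr // sqnorm_ge0. Qed.

Lemma enormZ a u : enorm (a *: u) = `|a| * enorm u.
Proof.
rewrite /enorm (_ : sqnorm (a *: u) = a ^+ 2 * sqnorm u).
  by rewrite sqrtrM ?sqr_ge0 // sqrtr_sqr.
by rewrite /sqnorm mulr_sumr; apply: eq_bigr => i _; rewrite mxE exprMn.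
Qed.

Lemma enorm_continuous : continuous enorm.
Proof.
move=> u; apply: (@cts_comp _ _ _ (@sqnorm R n) (@Num.sqrt R)); last exact: sqrt_continuous.
apply: continuous_sum => i _ v; apply: (cts_comp (g := fun x : R => x ^+ 2)).
  exact: coord_row_continuous.
exact: exprn_continuous.
Qed.

Lemma enorm_coord u j : `|u ord0 j| <= enorm u.
Proof.
rewrite -sqrtr_sqr ler_wsqrtr // /sqnorm (bigD1 j) //= lerDl.
by apply: sumr_ge0 => i _; exact: sqr_ge0.
Qed.

Lemma enorm_ball_compact : compact [set u | enorm u <= 1].
Proof.
apply: bounded_closed_compact.
  exists 1; split => // M M1 u /= u1; apply/ltW/row_norm_lt.
    exact: lt_trans ltr01 M1.
  by move=> j; apply: le_lt_trans M1; apply: le_trans (enorm_coord u j) u1.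
have -> : [set u | enorm u <= 1] = enorm @^-1` [set x | x <= 1] by [].
apply: preimage_closed; last exact: closed_le.
by move=> u _; exact: enorm_continuous.
Qed.

Definition unitv u := (enorm u)^-1 *: u.

Lemma enorm_unitv u : 0 < enorm u -> enorm (unitv u) = 1.
Proof. by move=> u0; rewrite enormZ ger0_norm ?invr_ge0 ?enorm_ge0 // mulVf ?gt_eqF. Qed.

Lemma unitv_id u : enorm u = 1 -> unitv u = u.
Proof. by move=> u1; rewrite /unitv u1 invr1 scale1r. Qed.

Lemma unitvZ a u : 0 < a -> unitv (a *: u) = unitv u.
Proof.
move=> a0; rewrite /unitv enormZ gtr0_norm // scalerA invfM mulrAC mulVf ?mul1r //.
by rewrite gt_eqF.
Qed.

Lemma unitv_continuous u : 0 < enorm u -> {for u, continuous unitv}.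
Proof.
move=> u0; apply: continuousZ => //; apply: continuousV; last exact: enorm_continuous.
by rewrite gt_eqF.
Qed.
End EuclideanNorm.

Section Cut.
Variable R : realType.

Definition cut (x : R) : R := Num.min 1 (Num.max 0 (2 * x - 1)).

Lemma cut1 : cut 1 = 1.
Proof. by rewrite /cut (_ : 2 * 1 - 1 = 1); [rewrite (max_idPr ler01) minxx|lra]. Qed.

Lemma cut0 x : x <= 2^-1 -> cut x = 0.
Proof.
move=> x2; rewrite /cut (max_idPl _); first by rewrite (min_idPr ler01).
by lra.
Qed.

Lemma cut_lipschitz x y : `|cut x - cut y| <= 2 * `|x - y|.
Proof.
rewrite ler_norml; have [xy|xy] := ger0P (x - y);
rewrite /cut; case: (leP 0 (2 * x - 1)) => ?; case: (leP 0 (2 * y - 1)) => ?;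
case: (leP 1 (2 * x - 1)) => ?; case: (leP 1 (2 * y - 1)) => ?;
rewrite ?(min_idPr ler01); apply/andP; split; lra.
Qed.

Lemma cut_continuous : continuous cut.
Proof.
move=> x; apply: (@continuous_min R R (fun=> 1) (fun y => Num.max 0 (2 * y - 1))).
  exact: cst_continuous.
apply: (@continuous_max R R (fun=> 0) (fun y => 2 * y - 1)).
  exact: cst_continuous.
apply: cts_sub; last exact: cts_cst.
by apply: cts_mul => //; exact: cts_cst.
Qed.
End Cut.

Lemma row_mx_continuous (R : realType) (T : topologicalType) m n
  (f : T -> 'rV[R]_m) (g : T -> 'rV[R]_n) :
  continuous f -> continuous g -> continuous (fun x => row_mx (f x) (g x)).
Proof.
move=> cf cg; apply: continuous_row => j.
case: (fintype.splitP j) => k jk.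
  rewrite (_ : j = lshift n k); last exact: val_inj.
  rewrite [X in continuous X](_ : _ = fun x => f x ord0 k).
    move=> x; apply: (cts_comp (f := f) (g := fun u => u ord0 k)); first exact: cf.
    exact: coord_row_continuous.
  by apply/funext => x; rewrite row_mxEl.
rewrite (_ : j = rshift m k); last exact: val_inj.
rewrite [X in continuous X](_ : _ = fun x => g x ord0 k).
  move=> x; apply: (cts_comp (f := g) (g := fun u => u ord0 k)); first exact: cg.
  exact: coord_row_continuous.
by apply/funext => x; rewrite row_mxEr.
Qed.

(** A Euclidean neighbourhood retract, with total functions [i] and [r] whose continuity is asked
    only on [A] and at the points of [U]. *)
Definition euclidean_retract (R : realType) (Y : topologicalType) (A : set Y) :=
  exists N (i : Y -> 'rV[R]_N) (r : 'rV[R]_N -> Y) (U : set 'rV[R]_N),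
  [/\ open U, {within A, continuous i}, forall x, A x -> U (i x) /\ r (i x) = x,
      forall p, U p -> A (r p) & forall p, U p -> {for p, continuous r}].

(** * Attaching one cell to a Euclidean neighbourhood retract *)

Section AttachCell.
Variables (R : realType) (Y : topologicalType) (A : set Y) (n N : nat).
Variables (chi : 'rV[R]_n -> Y) (i : Y -> 'rV[R]_N) (r : 'rV[R]_N -> Y).
Variable U : set 'rV[R]_N.
Hypothesis Y_hausdorff : hausdorff_space Y.
Hypothesis A_closed : closed A.
Hypothesis chi_continuous : continuous chi.
Hypothesis chi_sphere : forall u, enorm u = 1 -> A (chi u).
Hypothesis chi_interior : forall u, enorm u < 1 -> ~ A (chi u).
Hypothesis chi_inj : forall u v, enorm u < 1 -> enorm v < 1 -> chi u = chi v -> u = v.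
Hypothesis U_open : open U.
Hypothesis i_continuous : {within A, continuous i}.
Hypothesis iU : forall x, A x -> U (i x).
Hypothesis iK : forall x, A x -> r (i x) = x.
Hypothesis rA : forall p, U p -> A (r p).
Hypothesis r_continuous : forall p, U p -> {for p, continuous r}.

Local Notation ball1 := [set u : 'rV[R]_n | enorm u <= 1].
Local Notation B := (A `|` chi @` ball1).

(* [cut] vanishes below 1/2, which hides the singularity of [unitv] at 0. *)
Definition cell_ext (u : 'rV[R]_n) : 'rV[R]_N := cut (enorm u) *: i (chi (unitv u)).
Local Notation G := cell_ext.

Lemma cell_ext_continuous : continuous G.
Proof.
move=> u; have [u2|u2] := ltP (enorm u) 2^-1.
  apply: (@cts_near_eq 'rV[R]_n 'rV[R]_N (fun=> 0) G); last exact: cts_cst.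
  apply: filterS (cts_lt (@enorm_continuous R n u) u2) => v v2.
  by rewrite /cell_ext cut0 ?scale0r // ltW.
have u0 : 0 < enorm u by apply: lt_le_trans u2; rewrite invr_gt0.
apply: (@continuousZ _ _ _ (fun v => cut (enorm v)) (fun v => i (chi (unitv v)))).
  by apply: (cts_comp (@enorm_continuous R n u)); exact: cut_continuous.
move=> W Wu; rewrite nbhs_simpl /=.
have cu : {for u, continuous (fun v => chi (unitv v))}.
  by apply: (cts_comp (unitv_continuous u0)); exact: chi_continuous.
have := cu _ (within_cts_near i_continuous (chi_sphere (enorm_unitv u0)) Wu).
rewrite nbhs_simpl /=; apply: filterS2 (cts_gt (@enorm_continuous R n u) u0) => v v0.
by apply; apply: chi_sphere; exact: enorm_unitv.
Qed.

Lemma cell_ext_sphere u : enorm u = 1 -> G u = i (chi u).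
Proof. by move=> u1; rewrite /cell_ext u1 cut1 scale1r unitv_id. Qed.

Lemma cell_ext_bound : exists2 C, 0 <= C &
  forall u, enorm u = 1 -> `|i (chi u)| <= C.
Proof.
have cB : compact (G @` ball1).
  apply: continuous_compact; last exact: enorm_ball_compact.
  by apply: continuous_subspaceT; exact: cell_ext_continuous.
have [M [_ MP]] := compact_bounded cB.
exists (`|M| + 1) => [|u u1]; first by rewrite addr_ge0.
rewrite -cell_ext_sphere //; apply: MP; last by exists u; rewrite //= u1.
by apply: le_lt_trans (ler_norm _) _; rewrite ltrDl.
Qed.

(** By compactness of the ball. If both quantities vanish at [u], then [u] is on the sphere and
    [i (chi u) = p0], so [chi u = r p0] and continuity of [chi] applies; otherwise their sum is
    bounded below near [u]. *)
Lemma chi_near p0 V : U p0 -> nbhs (r p0) V -> exists2 eta : R, 0 < eta &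
  forall u, enorm u <= 1 -> `|1 - enorm u| < eta -> `|G u - p0| < eta -> V (chi u).
Proof.
move=> Up0 Vp0.
have /compact_near_coveringP/(_ nat \oo (fun k u => `|1 - enorm u| < k.+1%:R^-1 ->
  `|G u - p0| < k.+1%:R^-1 -> V (chi u))) := @enorm_ball_compact R n.
move=> cov; have : \forall k \near \oo, ball1 `<=` (fun u : 'rV[R]_n =>
    `|1 - enorm u| < k.+1%:R^-1 -> `|G u - p0| < k.+1%:R^-1 -> V (chi u)).
  apply: cov => u /= u1.
  pose g v := `|1 - enorm v| + `|G v - p0|.
  have cg : {for u, continuous g}.
    apply: cts_add; apply: cts_norm; apply: cts_sub; try exact: cts_cst.
      exact: enorm_continuous.
    exact: cell_ext_continuous.
  have [g0|g0] := eqVneq (g u) 0.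
    have /andP[] : (`|1 - enorm u| == 0) && (`|G u - p0| == 0).
      by rewrite -paddr_eq0 //; exact/eqP.
    rewrite !normr_eq0 !subr_eq0 => /eqP nu1 /eqP Gp0.
    have Vu : nbhs (chi u) V.
      suff -> : chi u = r p0 by [].
      by rewrite -Gp0 cell_ext_sphere // iK //; exact: chi_sphere.
    have cu := @chi_continuous u _ Vu.
    exists ([set v | V (chi v)], setT) => /=; first by split => //; exact: filterT.
    by move=> [v k] /= [].
  have gp : 0 < g u by rewrite lt0r g0 addr_ge0.
  have g2 : 0 < g u / 2 by rewrite divr_gt0.
  have g4 : 0 < g u / 4 by rewrite divr_gt0.
  exists ([set v | g u / 2 < g v], [set k | (k.+1%:R^-1 : R) < g u / 4]) => /=.
    split; last exact: (near_infty_natSinv_lt (PosNum g4)).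
    have gh : g u / 2 < g u by rewrite ltr_pdivrMr // mulr_natr mulr2n ltrDl.
    exact: (cts_gt cg gh).
  move=> [v k] /= [gv kg] v1 vp; exfalso.
  have : g v < g u / 4 + g u / 4 by apply: ltrD; apply: lt_trans kg.
  by move: gv; move: (g u) (g v) => a b; lra.
move=> /filter_ex[k kP]; exists k.+1%:R^-1; first by rewrite invr_gt0.
by move=> u u1; exact: kP.
Qed.

Local Notation space := 'rV[R]_(N + (1 + n)).
Implicit Types z : space.

(** The ambient space is a product with coordinates (p, a, w). A cell point [u] is embedded by
    [cell_embed] with [a = 1 - enorm u ^+ 2] and [w = a *: u], so [w] divided by [a] recovers it
    inside the cell. *)
Definition pos z : 'rV[R]_N := lsubmx z.
Definition depth z : R := lsubmx (rsubmx z) ord0 ord0.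
Definition cell_coord z : 'rV[R]_n := (depth z)^-1 *: rsubmx (rsubmx z).
Definition defect z : R :=
  (`|pos z - G (cell_coord z)| + `|enorm (cell_coord z) ^+ 2 - (1 - depth z)|) / depth z.
(** Dividing by it fixes points of the ball at defect 0 and, from defect 1 on, normalizes nonzero
    points to the sphere. *)
Definition radius z : R := Num.max (enorm (cell_coord z)) (1 - defect z).
Definition pushed z : 'rV[R]_n := (radius z)^-1 *: cell_coord z.
Definition blend z : 'rV[R]_N :=
  let s := Num.min (defect z - 1) 1 in (1 - s) *: G (pushed z) + s *: pos z.

(* Where [depth z > 0], [z] encodes the point [cell_coord z] of the cell, up to
   an error that [defect z] measures relative to the depth.  As the defect grows
   from 0 to 1 that point is pushed to the boundary of the cell, and as it grows
   from 1 to 2 its image in [A] is dragged over to [r (pos z)]. *)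
Definition attach_retract z : Y :=
  if depth z <= 0 then r (pos z)
  else if defect z <= 1 then chi (pushed z) else r (blend z).
Local Notation rho := attach_retract.

Lemma pos_continuous : continuous pos.
Proof. exact: continuous_lsubmx. Qed.

Lemma depth_continuous : continuous depth.
Proof.
move=> z; apply: (cts_comp (f := fun z : space => lsubmx (rsubmx z))
  (g := fun t : 'rV[R]_1 => t ord0 ord0)); last exact: coord_row_continuous.
apply: (cts_comp (f := fun z : space => rsubmx z) (g := fun t => lsubmx t)).
  exact: continuous_rsubmx.
exact: continuous_lsubmx.
Qed.

Lemma cell_coord_continuous z : depth z != 0 -> {for z, continuous cell_coord}.
Proof.
move=> z0; apply: (@continuousZ _ _ _ (fun z => (depth z)^-1)
  (fun z : space => rsubmx (rsubmx z))).
  by apply: continuousV => //; exact: depth_continuous.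
apply: (cts_comp (f := fun z : space => rsubmx z) (g := fun t => rsubmx t)).
  exact: continuous_rsubmx.
exact: continuous_rsubmx.
Qed.

Lemma defect_continuous z : depth z != 0 -> {for z, continuous defect}.
Proof.
move=> z0; have cc := cell_coord_continuous z0.
apply: (cts_mul (s := fun z => `|pos z - G (cell_coord z)| +
    `|enorm (cell_coord z) ^+ 2 - (1 - depth z)|) (t := fun z => (depth z)^-1)).
  apply: (@cts_add R space R).
    apply: cts_norm; apply: cts_sub; first exact: pos_continuous.
    by apply: cts_comp cc _; exact: cell_ext_continuous.
  apply: cts_norm; apply: cts_sub.
    apply: (cts_comp (f := fun z => enorm (cell_coord z)) (g := fun x : R => x ^+ 2)).
      by apply: cts_comp cc _; exact: enorm_continuous.
    exact: exprn_continuous.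
  by apply: cts_sub; [exact: cts_cst|exact: depth_continuous].
by apply: continuousV => //; exact: depth_continuous.
Qed.

Lemma pushed_continuous z : depth z != 0 -> 0 < radius z ->
  {for z, continuous pushed}.
Proof.
move=> z0 rz; apply: (@continuousZ _ _ _ (fun z => (radius z)^-1) cell_coord);
  last exact: cell_coord_continuous.
apply: continuousV; first by rewrite gt_eqF.
apply: (@continuous_max R _ (fun z => enorm (cell_coord z)) (fun z => 1 - defect z)).
  apply: (cts_comp (f := cell_coord) (g := @enorm R n)).
    exact: cell_coord_continuous.
  exact: enorm_continuous.
by apply: cts_sub; [exact: cts_cst|exact: defect_continuous].
Qed.

Lemma blend_continuous z : depth z != 0 -> 0 < radius z ->
  {for z, continuous blend}.
Proof.
move=> z0 rz.
have cs : {for z, continuous (fun z => Num.min (defect z - 1) 1)}.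
  apply: (@continuous_min R _ (fun z => defect z - 1) (fun=> 1)).
    by apply: cts_sub; [exact: defect_continuous|exact: cts_cst].
  exact: cts_cst.
apply: (@cts_add R _ _ (fun z => (1 - Num.min (defect z - 1) 1) *: G (pushed z))
  (fun z => Num.min (defect z - 1) 1 *: pos z)).
  apply: (@continuousZ _ _ _ (fun z => 1 - Num.min (defect z - 1) 1) (fun z => G (pushed z))).
    by apply: cts_sub => //; exact: cts_cst.
  apply: (cts_comp (f := pushed) (g := G)); first exact: pushed_continuous.
  exact: cell_ext_continuous.
exact: (@continuousZ _ _ _ (fun z => Num.min (defect z - 1) 1) pos _ cs
  (@pos_continuous z)).
Qed.

Lemma enorm_pushed z : 0 < radius z -> enorm (pushed z) = enorm (cell_coord z) / radius z.
Proof. by move=> rz; rewrite enormZ ger0_norm ?invr_ge0 ?ltW // mulrC. Qed.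

Lemma enorm_pushed_le1 z : 0 < radius z -> enorm (pushed z) <= 1.
Proof. by move=> rz; rewrite enorm_pushed // ler_pdivrMr // mul1r le_max lexx. Qed.

Lemma enorm_pushed_eq1 z : 1 <= defect z -> 0 < enorm (cell_coord z) -> enorm (pushed z) = 1.
Proof.
move=> d1 u0; have e : radius z = enorm (cell_coord z).
  by apply/max_idPl; apply: le_trans (ltW u0); rewrite subr_le0.
by rewrite enorm_pushed e // divff ?gt_eqF.
Qed.

Lemma radius_gt0 z : defect z < 1 \/ 0 < enorm (cell_coord z) -> 0 < radius z.
Proof. by rewrite lt_max subr_gt0 => -[] ->; rewrite ?orbT. Qed.

(** The neighbourhood in [attach_cell] is the interior of the set of these points, so the task is to
    find them around the embedded space. *)
Definition good_point z := {for z, continuous rho} /\ B (rho z).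

Lemma good_depth_lt0 z : depth z < 0 -> U (pos z) -> good_point z.
Proof.
move=> z0 Uz; split; last by left; rewrite /rho (ltW z0); exact: rA.
apply: (@cts_near_eq _ _ (r \o pos)).
  apply: filterS (cts_lt (@depth_continuous z) z0) => y y0.
  by rewrite /rho ltW.
by apply: cts_comp; [exact: pos_continuous|exact: r_continuous].
Qed.

Lemma good_defect_lt1 z : 0 < depth z -> defect z < 1 -> good_point z.
Proof.
move=> z0 d1; have rz : 0 < radius z by apply: radius_gt0; left.
have zn : depth z != 0 by rewrite gt_eqF.
split; last first.
  right; rewrite /rho leNgt z0 /= ltW //; exists (pushed z) => //=.
  exact: enorm_pushed_le1.
apply: (@cts_near_eq _ _ (chi \o pushed)).
  apply: filterS2 (cts_gt (@depth_continuous z) z0) (cts_lt (defect_continuous zn) d1).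
  by move=> y y0 dy; rewrite /rho leNgt y0 /= ltW.
by apply: cts_comp; [exact: pushed_continuous|exact: chi_continuous].
Qed.

Lemma blend_far z : 2 <= defect z -> blend z = pos z.
Proof.
move=> d2; rewrite /blend (min_idPr _); last by lra.
by rewrite subrr scale0r add0r scale1r.
Qed.

Lemma good_defect_gt2 z : 0 < depth z -> 2 < defect z -> U (pos z) -> good_point z.
Proof.
move=> z0 d2 Uz; have zn : depth z != 0 by rewrite gt_eqF.
have rE y : 0 < depth y -> 2 < defect y -> rho y = r (pos y).
  move=> y0 dy; rewrite /rho leNgt y0 /= leNgt (lt_trans _ dy) /= ?ltr1n //.
  by rewrite blend_far // ltW.
split; last by left; rewrite rE //; exact: rA.
apply: (@cts_near_eq _ _ (r \o pos)).
  apply: filterS2 (cts_gt (@depth_continuous z) z0) (cts_gt (defect_continuous zn) d2).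
  by move=> y y0 dy; rewrite rE.
by apply: cts_comp; [exact: pos_continuous|exact: r_continuous].
Qed.

Lemma good_defect_ge1 z : 0 < depth z -> 1 <= defect z -> 0 < enorm (cell_coord z) ->
  U (blend z) -> good_point z.
Proof.
move=> z0 d1 u0 Ub; have rz : 0 < radius z by apply: radius_gt0; right.
have zn : depth z != 0 by rewrite gt_eqF.
have c1 : {for z, continuous (chi \o pushed)}.
  by apply: cts_comp; [exact: pushed_continuous|exact: chi_continuous].
have c2 : {for z, continuous (r \o blend)}.
  by apply: cts_comp; [exact: blend_continuous|exact: r_continuous].
split; last first.
  rewrite /rho leNgt z0 /=; case: ifP => _; last by left; exact: rA.
  by right; exists (pushed z) => //=; exact: enorm_pushed_le1.
pose h y := if defect y <= 1 then chi (pushed y) else r (blend y).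
apply: (@cts_near_eq _ _ h).
  by apply: filterS (cts_gt (@depth_continuous z) z0) => y y0; rewrite /rho leNgt y0.
have [d1'|d1'] := eqVneq (defect z) 1; last first.
  have dz : 1 < defect z by rewrite lt_neqAle eq_sym d1'.
  apply: (@cts_near_eq _ _ (r \o blend)) => //.
  apply: filterS (cts_gt (defect_continuous zn) dz) => y dy.
  by rewrite /h leNgt dy.
have hz : h z = chi (pushed z) by rewrite /h d1' lexx.
apply: (cts_pieces (f := chi \o pushed) (g := r \o blend)) => //; last first.
  by move=> y; rewrite /h; case: ifP; [left|right].
(* At defect 1 the two formulas agree: [pushed z] is on the sphere, where [r] undoes [i]. *)
rewrite hz /= /blend d1' subrr (min_idPl ler01) subr0 scale1r scale0r addr0.
rewrite cell_ext_sphere ?iK //; first by apply: chi_sphere; exact: enorm_pushed_eq1.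
exact: enorm_pushed_eq1.
Qed.

(** Defect at most 2 puts the squared norm of [cell_coord z] within [2 * depth z] of [1 - depth z],
    so both norm and radius are 1 up to [3 * depth z]. The push is radial: it changes [G] only
    through [cut], which is 2-Lipschitz. *)
Lemma tube_estimate C z : (forall u, enorm u = 1 -> `|i (chi u)| <= C) -> 0 <= C ->
  0 < depth z -> depth z <= 12^-1 -> defect z <= 2 ->
  [/\ 0 < enorm (cell_coord z), 0 < radius z, 1 - enorm (pushed z) <= 8 * depth z &
      `|pos z - G (pushed z)| <= (2 + 10 * C) * depth z].
Proof.
move=> iC C0 z0 z12 d2.
have dz : `|pos z - G (cell_coord z)| + `|enorm (cell_coord z) ^+ 2 - (1 - depth z)|
    <= 2 * depth z by rewrite -ler_pdivrMr.
have d0 : 0 <= defect z by rewrite divr_ge0 ?addr_ge0 // ltW.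
set a := depth z in z0 z12 dz *; set x := enorm (cell_coord z) in dz *.
have x0 : 0 <= x by exact: enorm_ge0.
have [dp dn] : `|pos z - G (cell_coord z)| <= 2 * a /\ `|x ^+ 2 - (1 - a)| <= 2 * a.
  have := normr_ge0 (pos z - G (cell_coord z)).
  have := normr_ge0 (x ^+ 2 - (1 - a)); split; lra.
move: dn; rewrite ler_norml => /andP[dn1 dn2].
have x1 : 1 - 3 * a <= x by nra.
have x2 : x <= 1 + 3 * a by nra.
set M := radius z.
have xM : x <= M by rewrite /M /radius le_max lexx.
have M2 : M <= 1 + 3 * a.
  rewrite /M /radius ge_max x2 /=; lra.
have M0 : 0 < M by lra.
have xp : 0 < x by lra.
have nw : enorm (pushed z) = x / M by rewrite enorm_pushed.
have h1 : M * (x / M) = x by rewrite mulrC divfK // gt_eqF.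
set y := x / M in nw h1.
have y1 : y <= 1 by rewrite ler_pdivrMr // mul1r.
(* [M - x <= 6 * a], and [a <= 12^-1] gives [M >= 3/4], whence the constant 8. *)
have y2 : 1 - y <= 8 * a.
  suff : M * (1 - y) <= M * (8 * a) by rewrite ler_pM2l.
  by rewrite mulrBr h1; nra.
split=> //; first by rewrite nw.
have uw : unitv (pushed z) = unitv (cell_coord z) by rewrite unitvZ // invr_gt0.
have Gd : `|G (cell_coord z) - G (pushed z)| <= 10 * C * a.
  rewrite /cell_ext uw -scalerBl normrZ nw -/x.
  apply: le_trans (_ : 2 * `|x - y| * C <= _).
    by apply: ler_pM => //; [exact: cut_lipschitz|apply: iC; exact: enorm_unitv].
  suff xy : `|x - y| <= 5 * a by nra.
  rewrite ler_norml; apply/andP; split.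
    suff : M * (- (5 * a)) <= M * (x - y) by rewrite ler_pM2l.
    by rewrite mulrBr h1; nra.
  suff : M * (x - y) <= M * (5 * a) by rewrite ler_pM2l.
  by rewrite mulrBr h1; nra.
rewrite -(subrK (G (cell_coord z)) (pos z)) -addrA.
by apply: le_trans (ler_normD _ _) _; lra.
Qed.

Lemma near_tube z0 m : depth z0 = 0 -> 0 < m -> \forall z \near z0,
  `|pos z - pos z0| < m /\ (0 < depth z -> defect z <= 2 ->
    [/\ 0 < enorm (cell_coord z), `|1 - enorm (pushed z)| < m &
        `|G (pushed z) - pos z0| < m]).
Proof.
move=> d0 m0; have [C C0 iC] := cell_ext_bound.
have D0 : 0 < 10 + 10 * C by lra.
(* The first bound is the range of [tube_estimate]; the second makes each of its two errors less
   than [m / 2]. *)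
pose e := Num.min 12^-1 (m / (2 * (10 + 10 * C))).
have e0 : 0 < e by rewrite lt_min invr_gt0 ltr0n /= divr_gt0 // mulr_gt0.
have m2 : 0 < m / 2 by rewrite divr_gt0.
have cp : {for z0, continuous (fun z => `|pos z - pos z0|)}.
  by apply: cts_norm; apply: cts_sub; [exact: pos_continuous|exact: cts_cst].
have p0 : `|pos z0 - pos z0| < m / 2 by rewrite subrr normr0.
have de : depth z0 < e by rewrite d0.
apply: filterS2 (cts_lt cp p0) (cts_lt (@depth_continuous z0) de) => z pz.
rewrite lt_min => /andP[z12 ze].
split; first by apply: lt_trans pz _; rewrite ltr_pdivrMr // mulr_natr mulr2n ltrDl.
move=> zp d2.
have [u0 rz n8 pG] := tube_estimate iC C0 zp (ltW z12) d2.
have ze2 : depth z * (2 * (10 + 10 * C)) < m by rewrite -ltr_pdivlMr // mulr_gt0.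
have Ca : 0 <= C * depth z by rewrite mulr_ge0 // ltW.
split=> //.
  rewrite ger0_norm ?subr_ge0 ?enorm_pushed_le1 //.
  by apply: le_lt_trans n8 _; lra.
rewrite -(subrK (pos z) (G _)) -addrA; apply: le_lt_trans (ler_normD _ _) _.
rewrite distrC; lra.
Qed.

(** All three formulas tend to [r (pos z0)]: the first by continuity of [r], the one through [chi]
    by [chi_near], and the one through [blend] by convexity of balls. *)
Lemma good_depth_eq0 z0 : depth z0 = 0 -> U (pos z0) -> good_point z0.
Proof.
move=> d0 U0; have rE : rho z0 = r (pos z0) by rewrite /rho d0 lexx.
split; last by left; rewrite rE; exact: rA.
move=> V; rewrite rE => V0; rewrite nbhs_simpl /=.
have [eta eta0 etaP] := chi_near U0 V0.
have /nbhs_ballP[e /= e0 eP] := r_continuous U0 V0.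
have m0 : 0 < Num.min e eta by rewrite lt_min e0.
apply: filterS (near_tube d0 m0) => z [pz tz].
have rV p : `|p - pos z0| < e -> V (r p).
  by move=> pe; apply: eP; rewrite mx_norm_ball /ball_ /= distrC.
have [pe peta] : `|pos z - pos z0| < e /\ `|pos z - pos z0| < eta.
  by move: pz; rewrite lt_min => /andP[].
rewrite /= /rho; case: (leP (depth z) 0) => zp; first exact: rV.
have [d2|d2] := leP (defect z) 2; last first.
  rewrite leNgt (lt_trans _ d2) ?ltr1n //= blend_far; first exact: rV.
  exact: ltW.
have [u0 nw Gw] := tz zp d2; move: nw Gw; rewrite !lt_min => /andP[_ nw] /andP[Ge Gw].
case: (leP (defect z) 1) => d1.
  by apply: etaP => //; apply: enorm_pushed_le1; apply: radius_gt0; right.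
apply: rV; apply: norm_convex_lt => //.
by rewrite le_min ler01 ge_min lexx orbT subr_ge0 ltW.
Qed.

Lemma near_good z0 : depth z0 = 0 -> U (pos z0) -> \forall z \near z0, good_point z.
Proof.
move=> d0 U0; have /nbhs_ballP[e /= e0 eP] : nbhs (pos z0) U.
  exact: open_nbhs_nbhs.
apply: filterS (near_tube d0 e0) => z [pz tz].
have inU p : `|p - pos z0| < e -> U p.
  by move=> pe; apply: eP; rewrite mx_norm_ball /ball_ /= distrC.
have [zn|zp|zz] := ltgtP (depth z) 0.
- by apply: good_depth_lt0 => //; exact: inU.
- have [d2|d2] := leP (defect z) 2; last first.
    by apply: good_defect_gt2 => //; exact: inU.
  have [d1|d1] := ltP (defect z) 1; first exact: good_defect_lt1.
  have [u0 _ Gw] := tz zp d2.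
  apply: good_defect_ge1 => //; apply: inU; apply: norm_convex_lt => //.
  by rewrite le_min ler01 ge_min lexx orbT subr_ge0 d1.
- by apply: good_depth_eq0 => //; exact: inU.
Qed.

(** On the sphere the last two blocks vanish and the first is [i (chi u)], so this glues with
    [(i x, 0, 0)] on [A]. *)
Definition cell_embed (u : 'rV[R]_n) : space :=
  row_mx (G u) (row_mx (const_mx (1 - enorm u ^+ 2)) ((1 - enorm u ^+ 2) *: u)).

Lemma cell_embed_continuous : continuous cell_embed.
Proof.
have cd : continuous (fun u : 'rV[R]_n => 1 - enorm u ^+ 2).
  move=> u; apply: (@cts_sub R _ R (fun=> 1) (fun u : 'rV[R]_n => enorm u ^+ 2)).
    exact: cts_cst.
  apply: (cts_comp (f := @enorm R n) (g := fun x : R => x ^+ 2)); first exact: enorm_continuous.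
  exact: exprn_continuous.
apply: row_mx_continuous; first exact: cell_ext_continuous.
apply: row_mx_continuous.
  apply: continuous_row => j.
  by rewrite [X in continuous X](_ : _ = fun u : 'rV[R]_n => 1 - enorm u ^+ 2) //;
    apply/funext => u; rewrite mxE.
move=> u; apply: (@continuousZ _ _ _ (fun u : 'rV[R]_n => 1 - enorm u ^+ 2) id) => //.
exact: cd.
Qed.

Lemma pos_row_mx p w : pos (row_mx p w) = p. Proof. exact: row_mxKl. Qed.

Lemma depth_row_mx p a w : depth (row_mx p (row_mx a w)) = a ord0 ord0.
Proof. by rewrite /depth row_mxKr row_mxKl. Qed.

Lemma cell_embed_inner u : enorm u < 1 ->
  [/\ 0 < depth (cell_embed u), defect (cell_embed u) = 0 &
      rho (cell_embed u) = chi u].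
Proof.
move=> u1; have du : depth (cell_embed u) = 1 - enorm u ^+ 2.
  by rewrite depth_row_mx mxE.
have d0 : 0 < 1 - enorm u ^+ 2 by have := enorm_ge0 u; nra.
have cu : cell_coord (cell_embed u) = u.
  rewrite /cell_coord du /cell_embed !row_mxKr scalerA mulVf ?scale1r //.
  by rewrite gt_eqF.
have df : defect (cell_embed u) = 0.
  rewrite /defect cu du pos_row_mx subrr normr0 add0r.
  by rewrite (_ : enorm u ^+ 2 - _ = 0) ?normr0 ?mul0r //; ring.
split; rewrite ?du //.
rewrite /rho leNgt du d0 /= df ler01 /pushed /radius cu df subr0 (max_idPr (ltW u1)).
by rewrite invr1 scale1r.
Qed.

Lemma attach_cell : euclidean_retract R B.
Proof.
(* [kap] inverts [chi] on the open cell and is arbitrary elsewhere. *)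
have /choice[kap kapP] : forall x, exists u, forall v, enorm v < 1 -> chi v = x -> v = u.
  move=> x; have [[u [u1 ux]]|noU] := pselect (exists u, enorm u < 1 /\ chi u = x).
    by exists u => v v1 vx; apply: chi_inj => //; rewrite vx.
  by exists 0 => v v1 vx; case: noU; exists v.
have [j [jA jchi]] : exists j : Y -> space,
    (forall x, A x -> j x = row_mx (i x) (row_mx 0 0)) /\
    (forall u, enorm u <= 1 -> j (chi u) = cell_embed u).
  exists (fun x => if pselect (A x) then row_mx (i x) (row_mx 0 0) else cell_embed (kap x)).
  split=> [x Ax|u]; first by case: pselect.
  rewrite le_eqVlt => /orP[/eqP u1|u1].
    have Au := chi_sphere u1; case: pselect => //= ?.
    rewrite -cell_ext_sphere // /cell_embed u1 expr1n subrr scale0r.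
    by congr (row_mx _ (row_mx _ _)); apply/matrixP => k l; rewrite !mxE.
  have nA := chi_interior u1; case: pselect => //= ?.
  by rewrite -(kapP _ _ u1 erefl).
have cB : compact (chi @` ball1).
  apply: continuous_compact; last exact: enorm_ball_compact.
  by apply: continuous_subspaceT; exact: chi_continuous.
exists (N + (1 + n))%N, j, rho, [set z | good_point z]°; split.
- exact: open_interior.
- apply: withinU_continuous => //; first exact: compact_closed.
    apply: (@subspace_eq_continuous _ _ _ (fun x => row_mx (i x) (row_mx 0 0))).
      by move=> x; rewrite inE => Ax; exact/esym/jA.
    have cr : continuous (fun p : 'rV[R]_N => row_mx p (row_mx 0 0) : space).
      apply: (@row_mx_continuous R _ N (1 + n)%N id (fun=> row_mx 0 0)) => p.
        exact: cvg_id.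
      exact: cst_continuous.
    move: i_continuous => /subspace_continuousP ci.
    apply/subspace_continuousP => x Ax.
    exact: (cvg_comp _ _ (ci x Ax) (cr (i x))).
  apply/subspace_continuousP => _ [u /= u1 <-] W.
  move=> Wj; have : nbhs (j (chi u)) W by exact: Wj.
  rewrite (jchi _ u1) => /nbhs_interior Wu.
  (* Continuity of [j] on the closed cell: [chi] maps compact sets to closed ones, so the image of
     the part of the ball that [cell_embed] sends outside the interior of [W] is closed, and it
     misses [chi u]. *)
  have cW : closed (chi @` (ball1 `&` ~` (cell_embed @^-1` W°))).
    apply: compact_closed => //; apply: continuous_compact.
      by apply: continuous_subspaceT; exact: chi_continuous.
    apply: compact_closedI; first exact: enorm_ball_compact.
    apply: open_closedC; apply: open_comp; last exact: open_interior.
    by move=> v _; exact: cell_embed_continuous.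
  have : nbhs (chi u) (~` (chi @` (ball1 `&` ~` (cell_embed @^-1` W°)))).
    apply: open_nbhs_nbhs; split; first exact: closed_openC.
    move=> [v [/= v1 vW] vu]; apply: vW; rewrite /= -jchi // vu jchi //.
    exact: nbhs_singleton.
  rewrite nbhs_simpl /= /within /=; apply: filterS => x nx [v /= v1 vx].
  rewrite -[from_subspace _ _ _]/(j x) -vx jchi //.
  apply: interior_subset; apply: contrapT => nW.
  by apply: nx; exists v.
- move=> x [Ax|[u /= u1 <-]].
    have d0 : depth (j x) = 0.
      by rewrite jA // depth_row_mx mxE.
    split; last by rewrite /rho d0 lexx jA // pos_row_mx iK.
    by apply: near_good => //; rewrite jA // pos_row_mx; exact: iU.
  have [Au|nAu] := pselect (A (chi u)).
    have d0 : depth (j (chi u)) = 0.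
      by rewrite jA // depth_row_mx mxE.
    split; last by rewrite /rho d0 lexx jA // pos_row_mx iK.
    by apply: near_good => //; rewrite jA // pos_row_mx; exact: iU.
  have ul : enorm u < 1.
    rewrite lt_neqAle u1 andbT; apply/eqP => ue.
    by apply: nAu; exact: chi_sphere.
  have [d0 df rE] := cell_embed_inner ul; rewrite jchi //; split=> //.
  have dn : depth (cell_embed u) != 0 by rewrite gt_eqF.
  have d1 : defect (cell_embed u) < 1 by rewrite df.
  apply: filterS2 (cts_gt (@depth_continuous _) d0) (cts_lt (defect_continuous dn) d1).
  by move=> z z0 zd; exact: good_defect_lt1.
- by move=> z /interior_subset[].
- by move=> z /interior_subset[].
Qed.

End AttachCell.

(** * Finite CW complexes as Euclidean neighbourhood retracts *)

Section FiniteCW.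
Variables (R : realType) (Y : topologicalType) (S : finite_CW_structure R Y).
Local Notation cell := (cw_cell S).
Local Notation open_cell e := (@cw_open_cell R Y S e).
Local Notation ball1 n := [set u : 'rV[R]_n | enorm u <= 1].

Lemma diskE n (u : 'rV[R]_n) : disk R n u = (enorm u <= 1) :> Prop.
Proof. by rewrite /disk /= -sqr_enorm expr_le1 // enorm_ge0. Qed.

Lemma disk_proj_subproof n (u : 'rV[R]_n) :
  (Num.max 1 (enorm u))^-1 *: u \in disk R n.
Proof.
have M0 : 0 < Num.max 1 (enorm u) by rewrite lt_max ltr01.
rewrite inE diskE enormZ gtr0_norm ?invr_gt0 // mulrC ler_pdivrMr // mul1r.
by rewrite le_max lexx orbT.
Qed.

(** A retraction of the whole space onto the disk, which extends characteristic maps to total maps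
    of row vectors. *)
Definition disk_proj n (u : 'rV[R]_n) : disk R n :=
  exist _ ((Num.max 1 (enorm u))^-1 *: u) (disk_proj_subproof u).

Lemma disk_proj_continuous n : continuous (@disk_proj n).
Proof.
apply: continuous_set_type => u.
apply: (@continuousZ _ _ _ (fun u => (Num.max 1 (enorm u))^-1) id) => //.
apply: continuousV; first by rewrite gt_eqF // lt_max ltr01.
apply: (@continuous_max R _ (fun=> 1) (@enorm R n)); first exact: cst_continuous.
exact: enorm_continuous.
Qed.

Lemma disk_projK n (t : disk R n) : disk_proj (val t) = t.
Proof.
apply: val_inj => /=; have := set_mem (valP t); rewrite diskE => t1.
by rewrite (max_idPl t1) invr1 scale1r.
Qed.

Lemma val_disk_proj n (u : 'rV[R]_n) : enorm u <= 1 -> val (disk_proj u) = u.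
Proof. by move=> u1 /=; rewrite (max_idPl u1) invr1 scale1r. Qed.

Definition cell_map (e : cell) (u : 'rV[R]_(cw_dim e)) : Y := cw_char e (disk_proj u).

Lemma cell_map_continuous e : continuous (@cell_map e).
Proof.
move=> u; apply: (cts_comp (f := @disk_proj _) (g := @cw_char _ _ S e)).
  exact: disk_proj_continuous.
exact: cts_fun.
Qed.

Lemma cell_map_open e u : enorm u < 1 -> open_cell e (@cell_map e u).
Proof.
move=> u1; exists (disk_proj u) => //; rewrite /open_disk /=.
by rewrite (max_idPl (ltW u1)) invr1 scale1r -sqr_enorm expr_lt1 // enorm_ge0.
Qed.

Lemma cell_map_sphere e u : enorm u = 1 ->
  exists2 e', (cw_dim e' < cw_dim e)%N & open_cell e' (@cell_map e u).
Proof.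
move=> u1; apply: (@cw_attach R Y S e); exists (disk_proj u) => //; rewrite /sphere /=.
by rewrite u1 maxxx invr1 scale1r -sqr_enorm u1 expr1n.
Qed.

Lemma cell_map_inj e u v : enorm u < 1 -> enorm v < 1 -> @cell_map e u = cell_map v -> u = v.
Proof.
move=> u1 v1 uv; have [g [_ gK]] := @cw_homeo R Y S e.
have inop w : enorm w < 1 -> disk_proj w \in open_disk R (cw_dim e).
  move=> w1; rewrite inE /open_disk /= (max_idPl (ltW w1)) invr1 scale1r.
  by rewrite -sqr_enorm expr_lt1 // enorm_ge0.
rewrite -(val_disk_proj (ltW u1)) -(val_disk_proj (ltW v1)); congr val.
by rewrite -(gK _ (inop _ u1)) -(gK _ (inop _ v1)); congr g.
Qed.

Lemma open_cell_map e x : open_cell e x -> exists2 u, enorm u <= 1 & @cell_map e u = x.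
Proof.
move=> [t _ tx]; exists (val t); last by rewrite /cell_map disk_projK.
by have := set_mem (valP t); rewrite diskE.
Qed.

Definition closed_cells (T : {set cell}) : set Y :=
  [set x | exists2 e, e \in T & (@cell_map e @` ball1 (cw_dim e)) x].

Lemma closed_cell_compact e : compact (@cell_map e @` ball1 (cw_dim e)).
Proof.
apply: continuous_compact; last exact: enorm_ball_compact.
by apply: continuous_subspaceT; exact: cell_map_continuous.
Qed.

Lemma closed_cells_compact T : compact (closed_cells T).
Proof.
have -> : closed_cells T = \big[setU/set0]_(e in T) (@cell_map e @` ball1 (cw_dim e)).
  rewrite -bigcup_pred; apply/seteqP; split=> [x [e eT xe]|x [e eT xe]];
    by exists e.
by apply: bigsetU_compact => e _; exact: closed_cell_compact.
Qed.

(** Induction on the number of cells: a cell of maximal dimension is removed, the rest is still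
    closed under passing to lower dimensions, and the cell is attached again by [attach_cell]. *)
Lemma cells_retract (y0 : Y) (T : {set cell}) :
  (forall e e', e \in T -> (cw_dim e' < cw_dim e)%N -> e' \in T) ->
  euclidean_retract R (closed_cells T).
Proof.
move: {2}#|T| (erefl #|T|) => k; elim: k T => [|k IH] T Tk Tdown.
  have -> : closed_cells T = set0.
    by rewrite -subset0 => x [e]; rewrite (cards0_eq Tk) inE.
  exists 0%N, (fun=> 0), (fun=> y0), set0; split=> //.
  exact: continuous_subspace0.
have [e0 e0T] : exists e, e \in T by apply/set0Pn; rewrite -card_gt0 Tk.
pose e := [arg max_(e > e0 in T) cw_dim e].
have [eT emax] : e \in T /\ forall e', e' \in T -> (cw_dim e' <= cw_dim e)%N.
  by rewrite /e; case: arg_maxnP.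
have Tdown' e1 e2 : e1 \in T :\ e -> (cw_dim e2 < cw_dim e1)%N -> e2 \in T :\ e.
  rewrite !inE => /andP[_ e1T] e21; rewrite (Tdown _ _ e1T e21) andbT.
  by apply: contraTN e21 => /eqP ->; rewrite -leqNgt emax.
have [N [i [r [U [Uo ci iK rA cr]]]]] : euclidean_retract R (closed_cells (T :\ e)).
  by apply: IH => //; rewrite (cardsD1 e) eT in Tk; case: Tk.
have -> : closed_cells T = closed_cells (T :\ e) `|` @cell_map e @` ball1 (cw_dim e).
  apply/seteqP; split=> [x [e' e'T xe']|x [[e' + xe']|xe]].
  - have [ee|ne] := eqVneq e' e; first by right; rewrite -ee.
    by left; exists e' => //; rewrite !inE ne.
  - by rewrite !inE => /andP[_ e'T]; exists e'.
  - by exists e.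
(* A closed cell consists of its open cell and points in open cells of smaller dimension. By
   maximality of [e], none of these is the open cell of [e]. *)
have dimP e' x : e' \in T :\ e -> (@cell_map e' @` ball1 (cw_dim e')) x ->
    ~ open_cell e x.
  rewrite !inE => /andP[ne e'T] [u /= u1 <-] ex.
  have uniq e1 : open_cell e1 (cell_map u) -> e1 = e.
    have [e2 [_ e2u]] := @cw_partition R Y S (cell_map u).
    by move=> h; rewrite -(e2u _ h) (e2u _ ex).
  move: u1; rewrite le_eqVlt => /orP[/eqP u1|u1].
    have [e1 d1 /uniq ee1] := cell_map_sphere u1.
    by have := emax _ e'T; rewrite leqNgt -ee1 d1.
  by move/eqP: ne; apply; apply: uniq; exact: cell_map_open.
apply: (attach_cell (i := i) (r := r) (U := U)) => //.
- exact: (@cw_hausdorff R Y S).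
- by apply: compact_closed; [exact: (@cw_hausdorff R Y S)|exact: closed_cells_compact].
- exact: cell_map_continuous.
- move=> u u1; have [e1 d1 x1] := cell_map_sphere u1.
  exists e1; last by have [v v1 vx] := open_cell_map x1; exists v.
  rewrite !inE (Tdown _ _ eT d1) andbT.
  by apply: contraTN d1 => /eqP ->; rewrite ltnn.
- move=> u u1 [e' e'T ue']; apply: (dimP _ _ e'T ue'); exact: cell_map_open.
- exact: cell_map_inj.
- by move=> x /iK[].
- by move=> x /iK[].
Qed.

Lemma closed_cellsT : closed_cells [set: cell] = [set: Y].
Proof.
apply/seteqP; split=> // x _; have [e [ex _]] := @cw_partition R Y S x.
exists e; first by rewrite inE.
by have [u u1 ux] := open_cell_map ex; exists u.
Qed.

Lemma finite_CW_compact : compact [set: Y].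
Proof. by rewrite -closed_cellsT; exact: closed_cells_compact. Qed.

Theorem finite_CW_euclidean_retract (y0 : Y) : euclidean_retract R [set: Y].
Proof. by rewrite -closed_cellsT; apply: cells_retract => // e e' _ _; rewrite inE. Qed.

End FiniteCW.

(** * Retracts of unions of rational balls *)

Section RationalNeighborhoods.
Variable R : realType.

Definition rational_ball N (b : 'rV[rat]_N * nat) : set 'rV[R]_N :=
  [set x | `|x - map_mx ratr b.1| < b.2.+1%:R^-1].

Lemma rational_ball_open N (b : 'rV[rat]_N * nat) : open (rational_ball b).
Proof.
have -> : rational_ball b =
    (fun x : 'rV[R]_N => `|x - map_mx ratr b.1|) @^-1` [set y | y < b.2.+1%:R^-1] by [].
apply: open_comp; last exact: open_lt.
move=> x _; apply: (@cts_norm R _ _ (fun x : 'rV[R]_N => x - map_mx ratr b.1)).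
by apply: (@cts_sub R _ _ id (fun=> map_mx ratr b.1)) => //; exact: cts_cst.
Qed.

Lemma rational_ball_basis N (U : set 'rV[R]_N) x : open U -> U x ->
  exists2 b, rational_ball b `<=` U & rational_ball b x.
Proof.
move=> oU Ux; have /nbhs_ballP[e /= e0 eU] : nbhs x U by exact: open_nbhs_nbhs.
have e2 : 0 < e / 2 by rewrite divr_gt0.
have [k ke] : exists k, (k.+1%:R^-1 : R) < e / 2.
  exact: filter_ex (near_infty_natSinv_lt (PosNum e2)).
(* Rounding at the finer scale [k.+2] keeps the error strictly below the radius [k.+1%:R^-1]. *)
pose c : 'rV[rat]_N := \row_j ((round k.+1 x ord0 j)%:~R / k.+2%:R).
have cE : map_mx ratr c = unround R k.+1 (round k.+1 x).
  by apply/rowP => j; rewrite !mxE fmorph_div /= ratr_int ratr_nat.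
have xc : `|unround R k.+1 (round k.+1 x) - x| < k.+1%:R^-1.
  by apply: round_near; rewrite ltf_pV2 ?posrE ?ltr0n // ltr_nat.
exists (c, k); last by rewrite /rational_ball /= cE distrC.
move=> y; rewrite /rational_ball /= cE => yc; apply: eU.
rewrite mx_norm_ball /ball_ /= distrC -(subrK (unround R k.+1 (round k.+1 x)) y) -addrA.
by apply: le_lt_trans (ler_normD _ _) _; rewrite [e]splitr ltrD // (lt_trans _ ke).
Qed.

Definition ball_code := {N : nat & seq ('rV[rat]_N * nat)}.

Definition ball_union (p : ball_code) : set 'rV[R]_(projT1 p) :=
  [set x | exists2 b, b \in projT2 p & rational_ball b x].

Arguments ball_union : clear implicits.

Lemma ball_union_open p : open (ball_union p).
Proof.
have -> : ball_union p = \bigcup_(b in [set` projT2 p]) rational_ball b.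
  by apply/seteqP; split=> x [b bp bx]; exists b.
by apply: bigcup_open => b _; exact: rational_ball_open.
Qed.

Lemma ball_union_between N (K U : set 'rV[R]_N) : compact K -> open U -> K `<=` U ->
  exists l : seq ('rV[rat]_N * nat),
    K `<=` ball_union (existT _ N l) /\ ball_union (existT _ N l) `<=` U.
Proof.
rewrite compact_cover => cK oU KU.
have [|x Kx|D DU KD] := cK _ [set b | rational_ball b `<=` U] (@rational_ball N).
- by move=> b _; exact: rational_ball_open.
- by have [b bU bx] := rational_ball_basis oU (KU _ Kx); exists b.
exists (finmap.enum_fset D); split=> [x /KD[b bD bx]|x [b bD bx]]; first by exists b.
by have := DU b bD; rewrite inE; apply.
Qed.

(** The embedded space is compact, so finitely many rational balls cover it inside the neighbourhood
    [U], and the retraction restricts to their union. *)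
Lemma finite_CW_ball_retract (Y : topologicalType) : finite_CW_structure R Y ->
  exists p (f : continuousType Y (ball_union p)) (g : continuousType (ball_union p) Y),
    forall y, g (f y) = y.
Proof.
(* An empty [Y] has no value for a total retraction; it is matched with the empty union of balls in
   dimension 0. *)
move=> S; have [[y0 _]|noY] := pselect (exists y : Y, True); last first.
  pose p : ball_code := existT _ 0%N [::].
  have noP (x : ball_union p) : False by have [] := set_mem (valP x).
  have noY' (y : Y) : False by apply: noY; exists y.
  pose f (y : Y) : ball_union p := False_rect _ (noY' y).
  pose g (x : ball_union p) : Y := False_rect _ (noP x).
  have cf : continuous f by move=> y; case: (noY' y).
  have cg : continuous g by move=> x; case: (noP x).
  by exists p, (mkcts cf), (mkcts cg) => y; case: (noY' y).
have [N [i [r [U [oU ci iK _ cr]]]]] := finite_CW_euclidean_retract S y0.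
have cK : compact (i @` [set: Y]).
  by apply: continuous_compact => //; exact: finite_CW_compact S.
have KU : i @` [set: Y] `<=` U by move=> _ [y _ <-]; exact: (iK y Logic.I).1.
have [l [Kl lU]] := ball_union_between cK oU KU.
pose p : ball_code := existT _ N l.
have iP y : i y \in ball_union p by apply/mem_set/Kl; exists y.
pose f (y : Y) : ball_union p := exist _ (i y) (iP y).
pose g (x : ball_union p) : Y := r (val x).
have cf : continuous f.
  by apply: continuous_set_type; apply/continuous_subspace_setT.
have cg : continuous g.
  move=> x; apply: (cts_comp (f := val : ball_union p -> _) (g := r)).
    exact: set_val_continuous.
  by apply/cr/lU/set_mem/(valP x).
by exists p, (mkcts cf), (mkcts cg) => y; exact: (iK y Logic.I).2.
Qed.
End RationalNeighborhoods.

Arguments ball_union : clear implicits.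

(** * Singular homology of spaces homotopy equivalent to finite CW complexes *)

Theorem corollary1p2 (R : realType) (K : fieldType) (nrm : field_norm R K)
    (d : nat) :
  exists s : functorial_seminorm nrm (CW_homology R K d),
    universal_finite_fsn s.
Proof.
pose W (p : ball_code) := homology R K d (ball_union R p).
pose F := CW_homology R K d.
pose e p := cid (homology_countably_spanned K (@ball_union_open R p) d).
pose retract (p : ball_code) (X : finite_CW_category R)
    (i : {linear F X -> W p}) (r : {linear W p -> F X}) :=
  exists (f : continuousType (sval X) (ball_union R p))
    (g : continuousType (ball_union R p) (sval X)),
  [/\ homotopic R (g \o f : continuousType _ _) (idfun : continuousType _ _),
      i =1 homology_map R K f d & r =1 homology_map R K g d].
apply: (@universal_finite_fsn_ex R K nrm _ F ball_code W (fun p => sval (e p))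
  _ retract).
- by move=> p v; exact: (svalP (e p)).
- move=> p X i r [f [g [gf ei er]]] a.
  by rewrite er ei -homology_map_comp (homotopic_homology_map _ gf) homology_map_id.
- move=> p X X' i r i' r' [f [g [_ ei _]]] [f' [g' [_ _ er']]].
  exists (g' \o f : continuousType _ _) => a.
  by rewrite er' ei -homology_map_comp.
move=> X; have [Y [S] [f [g [gf _]]]] := svalP X.
have [p [i [r ri]]] := finite_CW_ball_retract S.
exists p, (homology_map R K (i \o f : continuousType _ _) d).
exists (homology_map R K (g \o r : continuousType _ _) d).
exists (i \o f), (g \o r); split=> //.
(* [r] undoes [i] strictly, so the composite through the balls equals [g \o f], which is homotopic
   to the identity. *)
move: gf; congr (homotopic R _ _); apply/continuousEP => x /=.
by rewrite ri.
Qed.
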